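(* Let $m,n\ge0$ be integers, $a\in\mathbb{C}$, $R\in\mathbb{C}[\mathcal{E}]\otimes Z(U(\mathfrak{gl}(m|n)))$, and let $\lambda=(\lambda_i)_{i\in I}$ be a weight of $\mathfrak{gl}(m|n)$. For $i\in I$ put $f(i)=\sum_{j\in I,\,j<i}(-1)^{|j|}$. If for every $i\in I$ the number $a+f(i)-(-1)^{|i|}\lambda_i$ is not a nonnegative integer, then $\mathcal{F}_a\otimes L(\lambda)$, considered as a $\mathfrak{gl}(m+1|n)$-module via $\varphi_R$, is a highest weight module.
   Context: Everything is over $\mathbb{C}$ and $\mathbb{Z}/2$-graded. Let $I=\{1,\dots,m,\bar 1,\dots,\bar n\}$ and $\hat I=\{0\}\cup I$, ordered by $0<1<\dots<m<\bar1<\dots<\bar n$, with parity $|i|=0$ for unbarred and $|i|=1$ for barred indices. $\mathfrak{gl}(m+1|n)$ has basis the elementary matrices $e_{ij}$ ($i,j\in\hat I$) of parity $|i|+|j|$, with supercommutator bracket; $\mathfrak{gl}(m|n)$ is the subalgebra spanned by $e_{ij}$, $i,j\in I$. Cartan subalgebras are the diagonal matrices, $\mathfrak{n}^+$ denotes strictly upper triangular matrices (span of $e_{ij}$ with $i<j$), and a weight $\lambda$ is recorded by its values $\lambda_i=\lambda(e_{ii})$. A highest weight vector is a nonzero weight vector annihilated by $\mathfrak{n}^+$; a highest weight module is a module generated by a highest weight vector. $L(\lambda)$ is the simple $\mathfrak{gl}(m|n)$-module of highest weight $\lambda$ (simple quotient of the Verma module). $\mathcal{F}=\mathbb{C}[t_0^{\pm1},t_1,\dots,t_m]\otimes\Lambda_n$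 with $\Lambda_n$ the exterior algebra on odd generators $t_{\bar 1},\dots,t_{\bar n}$ (supercommutative); $\partial_i=\partial/\partial t_i$ is the left superderivative. $\mathcal{D}'(m|n)$ is the superalgebra of operators on $\mathcal{F}$ generated by left multiplications by $t_i/t_0$ and by $t_0\partial_i$, $i\in\hat I$. $\mathcal{E}=\sum_{i\in\hat I}t_i\partial_i$. The center of $\mathcal{D}'(m|n)\otimes U(\mathfrak{gl}(m|n))$ is $\mathbb{C}[\mathcal{E}]\otimes Z(U(\mathfrak{gl}(m|n)))$. For $a\in\mathbb{C}$, $\mathcal{F}_a$ is the $\mathcal{D}'(m|n)$-module with basis the formal monomials $t_0^{a-k_1-\cdots-k_{\bar n}}t_1^{k_1}\cdots t_m^{k_m}t_{\bar1}^{k_{\bar1}}\cdots t_{\bar n}^{k_{\bar n}}$, $k_1,\dots,k_m\in\mathbb{Z}_{\ge0}$, $k_{\bar1},\dots,k_{\bar n}\in\{0,1\}$, with the evident action. Tensor products use the usual sign rule. For $R$ central in $\mathcal{D}'(m|n)\otimes U(\mathfrak{gl}(m|n))$, $\varphi_R:U(\mathfrak{gl}(m+1|n))\to\mathcal{D}'(m|n)\otimes U(\mathfrak{gl}(m|n))$ is the superalgebra homomorphism with $e_{ab}\mapsto t_a\partial_b\otimes1+1\otimes e_{ab}+\delta_{ab}(-1)^{|a||b|}R$, $e_{a0}\mapsto t_a\partial_0\otimes1-\sum_{j\in I}(-1)^{|a||j|}\frac{t_j}{t_0}\otimes e_{aj}$, $e_{0b}\mapsto t_0\partial_b\otimes1$,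 $e_{00}\mapsto t_0\partial_0\otimes1+R$ for $a,b\in I$. *)

(* Defs.v *)
From HB Require Import structures.
From mathcomp Require Import all_boot all_order all_algebra.
From mathcomp Require Import generic_quotient ring_quotient.
From mathcomp Require Import finmap boolp.
From mathcomp Require Import monalg.

Set Implicit Arguments.
Unset Strict Implicit.
Unset Printing Implicit Defensive.

Import GRing.Theory.
Local Open Scope ring_scope.
Local Open Scope quotient_scope.

Section TwoSidedIdeal.
Variables (A : nzRingType) (T : Type) (r : T -> A).

Definition in_ideal (x : A) : Prop :=
  exists s : seq (A * T * A), x = \sum_(t <- s) t.1.1 * r t.1.2 * t.2.

Definition ideal_gen (x : A) : bool := `[< in_ideal x >].

Lemma ideal_genP x : reflect (in_ideal x) (x \in ideal_gen).
Proof. exact: asboolP. Qed.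

Lemma ideal_gen_zmod : zmod_closed ideal_gen.
Proof.
split=> [|x y]; first by apply/ideal_genP; exists [::]; rewrite big_nil.
move=> /ideal_genP[s ->] /ideal_genP[s' ->]; apply/ideal_genP.
exists (s ++ [seq (- t.1.1, t.1.2, t.2) | t <- s']).
rewrite big_cat big_map /= -sumrN; congr (_ + _).
by apply: eq_bigr => t _; rewrite !mulNr.
Qed.

HB.instance Definition _ := GRing.isZmodClosed.Build A ideal_gen ideal_gen_zmod.

Lemma ideal_genMl a x : x \in ideal_gen -> a * x \in ideal_gen.
Proof.
move=> /ideal_genP[s ->]; apply/ideal_genP.
exists [seq (a * t.1.1, t.1.2, t.2) | t <- s].
by rewrite big_map /= mulr_sumr; apply: eq_bigr => t _; rewrite !mulrA.
Qed.

Lemma ideal_genMr a x : x \in ideal_gen -> x * a \in ideal_gen.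
Proof.
move=> /ideal_genP[s ->]; apply/ideal_genP.
exists [seq (t.1.1, t.1.2, t.2 * a) | t <- s].
by rewrite big_map /= mulr_suml; apply: eq_bigr => t _; rewrite !mulrA.
Qed.

Lemma ideal_gen1 (B : nzRingType) (f : {rmorphism A -> B}) :
  (forall t, f (r t) = 0) -> 1 \notin ideal_gen.
Proof.
move=> fr; apply/ideal_genP => -[s] /(congr1 f); rewrite rmorph1 rmorph_sum.
rewrite big1 => [/eqP|t _]; first by rewrite oner_eq0.
by rewrite !rmorphM fr mulr0 mul0r.
Qed.

Definition ideal_quot := Quotient.quot (GRing.ZmodClosed.clone A ideal_gen _).
HB.instance Definition _ := GRing.Zmodule.on ideal_quot.
HB.instance Definition _ := EqQuotient.on ideal_quot.

Local Notation pi := (\pi_ideal_quot : A -> ideal_quot).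

Lemma piP x y : reflect (pi x = pi y) (x - y \in ideal_gen).
Proof. by rewrite Quotient.idealrBE; exact: eqP. Qed.

Lemma piD x y : pi (x + y) = pi x + pi y.
Proof. exact: Quotient.pi_add. Qed.

Lemma pi0 : pi 0 = 0.
Proof. exact: pi_zeror. Qed.

Lemma pi_ind (P : ideal_quot -> Prop) : (forall x, P (pi x)) -> forall x, P x.
Proof. by move=> h x; have := h (repr x); rewrite reprK. Qed.

Definition quot_mul (x y : ideal_quot) : ideal_quot := pi (repr x * repr y).

Lemma quot_mulE x y : quot_mul (pi x) (pi y) = pi (x * y).
Proof.
apply/piP; rewrite -[_ * repr _](addrNK (x * repr (pi y))) -mulrBl -addrA.
rewrite -mulrBr rpredD //.
  by apply: ideal_genMr; apply/piP; rewrite reprK.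
by apply: ideal_genMl; apply/piP; rewrite reprK.
Qed.

Lemma quot_mulA : associative quot_mul.
Proof.
elim/pi_ind=> x; elim/pi_ind=> y; elim/pi_ind=> z.
by rewrite !quot_mulE mulrA.
Qed.

Lemma quot_mul1x : left_id (pi 1) quot_mul.
Proof. by elim/pi_ind=> x; rewrite quot_mulE mul1r. Qed.

Lemma quot_mulx1 : right_id (pi 1) quot_mul.
Proof. by elim/pi_ind=> x; rewrite quot_mulE mulr1. Qed.

Lemma quot_mulDl : left_distributive quot_mul +%R.
Proof.
elim/pi_ind=> x; elim/pi_ind=> y; elim/pi_ind=> z.
by rewrite -piD !quot_mulE mulrDl piD.
Qed.

Lemma quot_mulDr : right_distributive quot_mul +%R.
Proof.
elim/pi_ind=> x; elim/pi_ind=> y; elim/pi_ind=> z.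
by rewrite -piD !quot_mulE mulrDr piD.
Qed.

Lemma quot_1neq0 : 1 \notin ideal_gen -> pi 1 != 0.
Proof. by rewrite -pi0 => h; apply/eqP => /piP; rewrite subr0; apply/negP. Qed.

End TwoSidedIdeal.

(* gl(m|n) is indexed by 'I_(m + n), in its natural order: the m unbarred     *)
(* (even) indices come first, followed by the n barred (odd) ones.            *)
Definition bar m n (i : 'I_(m + n)) : bool := (m <= i)%N.

(* Parity of the elementary matrix e_ij. *)
Definition ebar m n (i j : 'I_(m + n)) : bool := bar i (+) bar j.

Section GLModules.
Variables (C : fieldType) (m n : nat).
Local Notation I := 'I_(m + n).

Section Predicates.
Variable V : lmodType C.
Implicit Types (g : V -> V) (e : I -> I -> V -> V) (mu : I -> C) (v : V).

(* e i j is the operator by which e_ij acts. The Z/2-grading of V is given by *)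
(* its parity involution g, equal to 1 on the even part and to -1 on the odd. *)
Record is_glmodule g e : Prop := IsGLModule {
  parity_linear : linear g;
  parity_invol : involutive g;
  act_linear : forall i j, linear (e i j);
  act_parity : forall i j v, e i j (g v) = (-1) ^+ ebar i j *: g (e i j v);
  act_bracket : forall i j k l v,
    e i j (e k l v) - (-1) ^+ (ebar i j && ebar k l) *: e k l (e i j v) =
    (j == k)%:R *: e i l v
      - (-1) ^+ (ebar i j && ebar k l) *: ((i == l)%:R *: e k j v)
}.

Definition stable_subspace e (S : V -> Prop) : Prop :=
  [/\ S 0, forall c u v, S u -> S v -> S (c *: u + v)
    & forall i j v, S v -> S (e i j v)].

Definition generated_by e v : Prop :=
  forall S : V -> Prop, stable_subspace e S -> S v -> forall w, S w.

(* Submodules of a supermodule are graded. *)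
Definition simple_module g e : Prop :=
  (exists v : V, v != 0) /\
  forall S : V -> Prop, stable_subspace e S -> (forall v, S v -> S (g v)) ->
    (forall v, S v -> v = 0) \/ (forall v, S v).

Definition highest_weight_vector e mu v : Prop :=
  [/\ v != 0, forall i, e i i v = mu i *: v
    & forall i j : I, (i < j)%N -> e i j v = 0].

Definition highest_weight_module g e : Prop :=
  is_glmodule g e /\
  exists mu v, highest_weight_vector e mu v /\ generated_by e v.

(* V is a simple quotient of the Verma module of highest weight mu, i.e. it   *)
(* is L(mu), up to isomorphism and parity shift.                              *)
Definition is_simple_hw g e mu : Prop :=
  [/\ is_glmodule g e, simple_module g e
    & exists v, highest_weight_vector e mu v /\ generated_by e v].

End Predicates.

(* The enveloping superalgebra U(gl(m|n)): the quotient of the free algebra   *)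
(* on the symbols e_ij by the supercommutator relations.                      *)
Local Notation word := (fmonom (I * I)%type).
Local Notation free_gl := {malg C[word]}.

Definition fgen (i j : I) : free_gl := << fmu (i, j) >>.

Definition frel (t : (I * I) * (I * I)) : free_gl :=
  let: ((i, j), (k, l)) := t in
  let s : C := (-1) ^+ (ebar i j && ebar k l) in
  fgen i j * fgen k l - s *: (fgen k l * fgen i j)
    - ((j == k)%:R *: fgen i l - s *: ((i == l)%:R *: fgen k j)).

Lemma mcoeff1_fgen i j : (fgen i j)@_mone = 0.
Proof.
rewrite mcoeffU; case: eqP => // h.
by have := congr1 (fun w : word => fdeg w) h; rewrite fdegU fdeg1.
Qed.

Lemma rel_vanish (A : lalgType C) (f : A -> C) x y z w (s b c : C) :
    {morph f : u v / u - v} -> (forall k u, f (k *: u) = k * f u) ->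
    {morph f : u v / u * v} -> f x = 0 -> f y = 0 -> f z = 0 -> f w = 0 ->
  f (x * y - s *: (y * x) - (b *: z - s *: (c *: w))) = 0.
Proof.
move=> fB fZ fM x0 y0 z0 w0.
by rewrite !fB !fZ !fM x0 y0 z0 w0 !mulr0 !subr0.
Qed.

Lemma frel_aug t : mcoeff mone (frel t) = 0.
Proof.
case: t => [[i j] [k l]]; apply: rel_vanish; try exact: mcoeff1_fgen.
- exact: mcoeffB.
- by move=> c u; exact: mcoeffZ.
- exact: rmorphM.
Qed.

Definition Ugl := ideal_quot frel.
HB.instance Definition _ := GRing.Zmodule.on Ugl.
HB.instance Definition _ := EqQuotient.on Ugl.
HB.instance Definition _ := GRing.Zmodule_isNzRing.Build Ugl
  (@quot_mulA _ _ frel) (@quot_mul1x _ _ frel) (@quot_mulx1 _ _ frel)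
  (@quot_mulDl _ _ frel) (@quot_mulDr _ _ frel)
  (quot_1neq0 (ideal_gen1 frel_aug)).


Lemma Ugl_pi1 : \pi_Ugl 1 = 1.
Proof. by []. Qed.

Lemma Ugl_piM x y : \pi_Ugl (x * y) = \pi_Ugl x * \pi_Ugl y.
Proof. by rewrite /GRing.mul /= -quot_mulE. Qed.

Lemma lin0 (V W : lmodType C) (f : V -> W) : linear f -> f 0 = 0.
Proof.
by move=> fP; have := fP (-1) 0 0; rewrite scaler0 addr0 scaleN1r addNr.
Qed.

Lemma rel_map (A : lalgType C) (W : lmodType C) (f : A -> W) x y z w
    (s b c : C) (p q z' w' : W) :
    {morph f : u v / u - v} -> (forall k u, f (k *: u) = k *: f u) ->
    f (x * y) = p -> f (y * x) = q -> f z = z' -> f w = w' ->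
  f (x * y - s *: (y * x) - (b *: z - s *: (c *: w))) =
  p - s *: q - (b *: z' - s *: (c *: w')).
Proof. by move=> fB fZ <- <- <- <-; rewrite !fB !fZ. Qed.

Section Action.
Variables (V : lmodType C) (g : V -> V) (e : I -> I -> V -> V).

Definition word_act (w : word) (v : V) : V :=
  foldr (fun ij => e ij.1 ij.2) v w.

Definition free_act (x : free_gl) (v : V) : V :=
  \sum_(w <- msupp x) x@_w *: word_act w v.

(* The action of U(gl(m|n)) on a gl(m|n)-module; by uact_pi below it does not *)
(* depend on the choice of representatives.                                   *)
Definition uact (u : Ugl) (v : V) : V := free_act (repr u) v.

Lemma free_actEw (d : {fset word}) x v : (msupp x `<=` d)%fset ->
  free_act x v = \sum_(w <- d) x@_w *: word_act w v.
Proof.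
move=> le; rewrite [LHS](big_fset_incl _ le) => //= w _ /mcoeff_outdom ->.
by rewrite scale0r.
Qed.

Lemma free_actB x y v : free_act (x - y) v = free_act x v - free_act y v.
Proof.
pose d := (msupp (x - y) `|` (msupp x `|` msupp y))%fset.
rewrite !(@free_actEw d) ?fsubsetUl //.
- by rewrite -sumrB; apply: eq_bigr => w _; rewrite mcoeffB scalerBl.
- by rewrite /d fsetUA fsubsetUr.
- by rewrite /d fsetUCA fsubsetUl.
Qed.

Lemma free_act0 v : free_act 0 v = 0.
Proof. by rewrite -(subrr 0) free_actB subrr. Qed.

Lemma free_actD x y v : free_act (x + y) v = free_act x v + free_act y v.
Proof.
by have := free_actB (x + y) y v; rewrite addrK => ->; rewrite subrK.
Qed.

Lemma free_act_sum (T : Type) (s : seq T) (f : T -> free_gl) v :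
  free_act (\sum_(t <- s) f t) v = \sum_(t <- s) free_act (f t) v.
Proof.
elim: s => [|t s IH]; first by rewrite !big_nil free_act0.
by rewrite !big_cons free_actD IH.
Qed.

Lemma free_actU c w v : free_act << c *g w >> v = c *: word_act w v.
Proof.
by rewrite (free_actEw _ msuppU_le) big_seq_fset1 mcoeffUU.
Qed.

Lemma free_actZ c x v : free_act (c *: x) v = c *: free_act x v.
Proof.
rewrite (free_actEw _ (msuppZ_le _ _)) scaler_sumr.
by apply: eq_bigr => w _; rewrite mcoeffZ scalerA.
Qed.

Lemma free_act_gen i j v : free_act (fgen i j) v = e i j v.
Proof. by rewrite free_actU scale1r /word_act fmU. Qed.

Hypothesis He : is_glmodule g e.

Lemma word_actP w : linear (word_act w).
Proof.
rewrite /word_act; elim: (w : seq _) => [|ij s IH] c u v //=.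
by rewrite IH (act_linear He).
Qed.

Lemma free_actP x : linear (free_act x).
Proof.
move=> c u v; rewrite scaler_sumr -big_split; apply: eq_bigr => w _ /=.
by rewrite word_actP scalerDr !scalerA mulrC.
Qed.

Lemma free_act_sumr x (T : Type) (s : seq T) (f : T -> V) :
  free_act x (\sum_(t <- s) f t) = \sum_(t <- s) free_act x (f t).
Proof.
have x0 : free_act x 0 = 0.
  exact: lin0 (free_actP x).
elim: s => [|t s IH]; first by rewrite !big_nil.
by rewrite !big_cons -[f t]scale1r free_actP IH !scale1r.
Qed.

Lemma free_actM x y v : free_act (x * y) v = free_act x (free_act y v).
Proof.
rewrite malgME free_act_sum [RHS]/free_act; apply: eq_bigr => w _.
rewrite free_act_sum [free_act y v]/free_act.
have wP := word_actP w.
have w0 := lin0 wP.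
elim: (enum_fset (msupp y)) => [|u s IH]; first by rewrite !big_nil w0 scaler0.
rewrite !big_cons wP scalerDr IH free_actU scalerA; congr (_ *: _ + _).
by rewrite /word_act fmM foldr_cat.
Qed.

Lemma free_actM_gen i j k l v :
  free_act (fgen i j * fgen k l) v = e i j (e k l v).
Proof. by rewrite free_actM !free_act_gen. Qed.

Lemma free_act_rel t v : free_act (frel t) v = 0.
Proof.
case: t => [[i j] [k l]]; rewrite /frel.
have fB x y : free_act (x - y) v = free_act x v - free_act y v.
  exact: free_actB.
have fZ c x : free_act (c *: x) v = c *: free_act x v by exact: free_actZ.
rewrite [LHS](@rel_map _ _ (free_act^~ v) _ _ _ _ _ _ _ _ _ _ _ fB fZ (free_actM_gen i j k l v) (free_actM_gen k l i j v)
  (free_act_gen i l v) (free_act_gen k j v)).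
by rewrite (act_bracket He) subrr.
Qed.

Lemma uact_pi x v : uact (\pi_Ugl x) v = free_act x v.
Proof.
apply/eqP; rewrite -subr_eq0 -free_actB; apply/eqP.
have /ideal_genP[s ->] : repr (\pi_Ugl x) - x \in ideal_gen frel.
  by apply/piP; exact: (@reprK _ Ugl).
rewrite free_act_sum big1 // => t _.
rewrite !free_actM free_act_rel.
exact: lin0 (free_actP _).
Qed.

Lemma uact1 v : uact 1 v = v.
Proof.
by rewrite -Ugl_pi1 uact_pi free_actU scale1r /word_act fm1.
Qed.

Lemma uactM x y v : uact (x * y) v = uact x (uact y v).
Proof.
elim/pi_ind: x => x; elim/pi_ind: y => y.
by rewrite -Ugl_piM !uact_pi free_actM.
Qed.

Lemma uact_gen i j v : uact (\pi_Ugl (fgen i j)) v = e i j v.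
Proof. by rewrite uact_pi free_act_gen. Qed.

End Action.
End GLModules.

(* Monalg makes {malg V[K]} an lmodType only when V is the scalar ring. *)
Section VectMalg.
Variables (C : fieldType) (K : choiceType) (V : lmodType C).

Definition vect_malg := {malg V[K]}.
HB.instance Definition _ := GRing.Zmodule.on vect_malg.
Implicit Types (c : C) (w : vect_malg).

Definition vm_scale c w : vect_malg := [malg k in msupp w => c *: w@_k].

Lemma vm_scaleE c w k : (vm_scale c w)@_k = c *: w@_k.
Proof. by rewrite mcoeffE; case: msuppP; rewrite ?scaler0. Qed.

Lemma vm_scaleA b c w : vm_scale b (vm_scale c w) = vm_scale (b * c) w.
Proof. by apply/malgP => k; rewrite !vm_scaleE scalerA. Qed.

Lemma vm_scale1 : left_id 1 vm_scale.
Proof. by move=> w; apply/malgP => k; rewrite vm_scaleE scale1r. Qed.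

Lemma vm_scaleDr : right_distributive vm_scale +%R.
Proof.
by move=> c w x; apply/malgP => k; rewrite mcoeffD !vm_scaleE mcoeffD scalerDr.
Qed.

Lemma vm_scaleDl w : {morph vm_scale^~ w : b c / b + c}.
Proof.
by move=> b c; apply/malgP => k; rewrite mcoeffD !vm_scaleE scalerDl.
Qed.

HB.instance Definition _ := GRing.Zmodule_isLmodule.Build C vect_malg
  vm_scaleA vm_scale1 vm_scaleDr vm_scaleDl.

End VectMalg.

Section Fock.
Variables (C : fieldType) (m n : nat).
Local Notation I := 'I_(m + n).

(* An exponent k stands for the formal monomial                               *)
(*   t_0^(a - \sum_i k_i) t_1^(k_1) ... t_bar n^(k_bar n)                     *)
(* of F_a, the exponent of t_0 being determined by a and k.                   *)
Definition exponent := {ffun I -> nat}.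

Definition admissible (k : exponent) : bool :=
  [forall i : I, bar i ==> (k i <= 1)%N].

Definition monomial := {k : exponent | admissible k}.

(* The space F_a; only the action of t_0 d/dt_0 below depends on a. *)
Definition fock := {malg C[monomial]}.
HB.instance Definition _ := GRing.Lmodule.on fock.

(* A product of the t_i containing the square of an odd one vanishes. *)
Definition fmon (k : exponent) : fock :=
  if insub k is Some x then << (x : monomial) >> else 0.

Definition incr (i : I) (k : exponent) : exponent :=
  [ffun j => (k j + (j == i))%N].
Definition decr (i : I) (k : exponent) : exponent :=
  [ffun j => (k j - (j == i))%N].

Definition odd_exponent (k : exponent) : bool :=
  odd (\sum_(i : I | bar i) k i).

(* The sign for moving t_i or d/dt_i past the t_j^(k_j) with j < i. *)
Definition move_sign (i : I) (k : exponent) : C :=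
  (-1) ^+ (bar i && odd (\sum_(j : I | bar j && (j < i)%N) k j)).

Definition fock_ext (h : exponent -> fock) (x : fock) : fock :=
  \sum_(k <- msupp x) x@_k *: h (val k).

(* The operators t_i / t_0 and t_0 d/dt_i for i in I, then t_0 d/dt_0. *)
Definition op_t (i : I) : fock -> fock :=
  fock_ext (fun k => move_sign i k *: fmon (incr i k)).
Definition op_d (i : I) : fock -> fock :=
  fock_ext (fun k => (move_sign i k * (k i)%:R) *: fmon (decr i k)).
Definition op_d0 (a : C) : fock -> fock :=
  fock_ext (fun k => (a - (\sum_i k i)%:R) *: fmon k).

Definition euler (a : C) (x : fock) : fock :=
  op_d0 a x + \sum_i op_t i (op_d i x).

(* F_a (x) V, as the finitely supported families of vectors of V indexed by   *)
(* the monomial basis of F_a.                                                 *)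
Definition fock_tensor (V : lmodType C) := vect_malg monomial V.
HB.instance Definition _ V := GRing.Lmodule.on (fock_tensor V).

Section TensorOperators.
Variable V : lmodType C.

Definition pure (x : fock) (v : V) : fock_tensor V :=
  \sum_(k <- msupp x) << x@_k *: v *g k >>.

(* A (x) B for an operator B of parity p, with the sign rule                  *)
(*   (A (x) B) (f (x) v) = (-1)^(p |f|) A f (x) B v.                          *)
Definition tensor_op (p : bool) (A : fock -> fock) (B : V -> V)
    (w : fock_tensor V) : fock_tensor V :=
  \sum_(k <- msupp w)
    (-1) ^+ (p && odd_exponent (val k)) *: pure (A << k >>) (B w@_k).

(* The parity involution of F_a (x) V is the tensor product of those of F_a   *)
(* and V; the former is the sign occurring in tensor_op.                      *)
Definition tensor_parity (g : V -> V) : fock_tensor V -> fock_tensor V :=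
  tensor_op true id g.

Variables (a : C) (r : {poly Ugl C m n}) (e : I -> I -> V -> V).

(* The action of R = \sum_k E^k (x) r_k, with E the Euler operator: elements  *)
(* of C[E] (x) Z(U(gl(m|n))) are polynomials in E with coefficients in the    *)
(* center. The center is purely even, hence no sign.                          *)
Definition central_op (w : fock_tensor V) : fock_tensor V :=
  \sum_(k < size r) tensor_op false (iter k (euler a)) (uact e r`_k) w.

(* The action of e_AB in gl(m+1|n) on F_a (x) V through phi_R. The index 0 is *)
(* ord0, and lift ord0 identifies I with the other indices.                   *)
Definition phi_act (A B : 'I_(m.+1 + n)) (w : fock_tensor V) : fock_tensor V :=
  match @unlift (m + n).+1 ord0 A, @unlift (m + n).+1 ord0 B with
  | Some i, Some j =>
      tensor_op false (op_t i \o op_d j) id w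
      + tensor_op (ebar i j) id (e i j) w
      + ((i == j)%:R * (-1) ^+ (bar i && bar j)) *: central_op w
  | Some i, None =>
      tensor_op false (op_t i \o op_d0 a) id w
      - \sum_j (-1) ^+ (bar i && bar j) *:
          tensor_op (ebar i j) (op_t j) (e i j) w
  | None, Some j => tensor_op false (op_d j) id w
  | None, None => tensor_op false (op_d0 a) id w + central_op w
  end.

End TensorOperators.

Definition signed_count (i : I) : C := \sum_(j : I | (j < i)%N) (-1) ^+ bar j.

End Fock.

(* Main.v *)
Require Import Defs.
From HB Require Import structures.
From mathcomp Require Import all_boot all_order all_algebra.
From mathcomp Require Import finmap boolp monalg.
From mathcomp Require Import reals complex.

Set Implicit Arguments.
Unset Strict Implicit.
Unset Printing Implicit Defensive.

Import GRing.Theory.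
Local Open Scope ring_scope.
Local Open Scope complex_scope.

(* A central element of U(gl(m|n)) acts on L(lambda) by a scalar, because the *)
(* lambda-weight space is a line; and E acts on F_a by a. So R acts by a      *)
(* scalar, and the bracket relations reduce to super-commutation rules        *)
(* between t_i/t_0, t_0 d/dt_i, t_0 d/dt_0 and the e_ij.                      *)
(* The vector t_0^a (x) v, with v the highest weight vector of L(lambda), is  *)
(* a highest weight vector. Let M be the submodule it generates. Inductively  *)
(* on d, M contains f (x) L(lambda) for all f of degree d in the t_i, i in I: *)
(* assuming this for d, the vector e_i0 (f (x) v) is                          *)
(*   (a - d) t_i f (x) v - \sum_(j <= i) +- t_j f (x) e_ij v,                 *)
(* and for j < i, t_j f (x) e_ij v is congruent to +- t_i f (x) v modulo      *)
(* e_ij (t_j f (x) v) and t_j f' (x) v with f' = t_i d/dt_j f. By induction   *)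
(* on i, M thus contains                                                      *)
(*   (a - d - (-1)^|i| lambda_i + f(i)) t_i f (x) v,                          *)
(* whose coefficient does not vanish by assumption.                           *)

(** * The Fock space *)

(** Three facts carry the proof. First, R acts on the tensor product by a scalar
    ([central_op_scalar]). The Euler operator is the number a by [eulerE], and a central element of
    U(gl(m|n)) preserves the lambda-weight space of L(lambda), which is a line by
    [weight_space_dim1]: L(lambda) is spanned by words in lowering elements applied to v, and the
    operator [height] separates v from all words of positive length. Second, once R is a central
    element z, the compatibility of phi_R with brackets is formal ([phi_bracket]). It follows in any
    ring from the Weyl-Clifford relations ([op_tC], [op_dC], [op_dt], [op_d0_t], [op_d0_d]), the
    relations of gl(m|n), and the fact that the two families supercommute. This gives
    [phi_act_glmodule]. Third, the submodule M generated by t_0^a (x) v is everything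
    ([homogeneous_tensor]), by induction on the degree d. [homogeneous_full] replaces v by an
    arbitrary vector of L(lambda). [raise_full] passes to degree d + 1: in e_i0 (f (x) v) the terms
    with j > i vanish, the term j = i gives lambda_i, and [raise_coef] trades each term with j < i
    for a multiple of t_i f (x) v, these adding up to f(i). The resulting coefficient a - d + f(i) -
    (-1)^|i| lambda_i is nonzero because the number in the hypothesis differs from d. *)

Section SupportSums.
Variables (C : fieldType) (K : choiceType) (G : zmodType) (W : lmodType C).
Implicit Types (F : K -> G -> W) (x y z : {malg G[K]}).

Lemma msum_widen F (d : {fset K}) x : (forall k, F k 0 = 0) ->
    (msupp x `<=` d)%fset ->
  \sum_(k <- msupp x) F k x@_k = \sum_(k <- d) F k x@_k.
Proof.
move=> F0 le; rewrite [LHS](big_fset_incl _ le) //= => k _.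
by move=> /mcoeff_outdom ->; rewrite F0.
Qed.

(** The coefficients form a mere abelian group, so [z] is tied to [x] and [y] through the terms
    only. This covers both the scalar coefficients of [fock] and the vector coefficients of
    [fock_tensor]. *)
Lemma msum_linear F (c : C) x y z : (forall k, F k 0 = 0) ->
    (forall k, F k z@_k = c *: F k x@_k + F k y@_k) ->
  \sum_(k <- msupp z) F k z@_k =
    c *: (\sum_(k <- msupp x) F k x@_k) + \sum_(k <- msupp y) F k y@_k.
Proof.
move=> F0 Fz; pose d := (msupp x `|` (msupp y `|` msupp z))%fset.
have dx : (msupp x `<=` d)%fset by exact: fsubsetUl.
have dy : (msupp y `<=` d)%fset by rewrite /d fsetUCA fsubsetUl.
have dz : (msupp z `<=` d)%fset by rewrite /d !fsetUA fsubsetUr.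
rewrite !(msum_widen F0 dx, msum_widen F0 dy, msum_widen F0 dz).
by rewrite scaler_sumr -big_split; apply: eq_bigr => k _; rewrite Fz.
Qed.

Lemma msumU F (c : G) k : (forall k, F k 0 = 0) ->
  \sum_(l <- msupp << c *g k >>) F l << c *g k >>@_l = F k c.
Proof.
move=> F0; rewrite (msum_widen F0 msuppU_le) big_seq_fset1.
by rewrite mcoeffUU.
Qed.

End SupportSums.

Section FockSpace.
Variables (C : fieldType) (m n : nat).
Local Notation I := 'I_(m + n).
Local Notation F := (fock C m n).
Local Notation exponent := (exponent m n).
Local Notation monomial := (monomial m n).
Implicit Types (x y : F) (k : exponent) (i j : I).

Lemma fock_ext_linear (h : exponent -> F) : linear (fock_ext h).
Proof.
move=> c x y.
apply: (msum_linear (F := fun (k : monomial) (b : C) => b *: h (val k))).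
  by move=> k; rewrite scale0r.
by move=> k; rewrite mcoeffD mcoeffZ scalerDl scalerA.
Qed.

Lemma fock_extU (h : exponent -> F) (k : monomial) :
  fock_ext h << k >> = h (val k).
Proof.
rewrite [LHS](msumU (F := fun (k : monomial) (b : C) => b *: h (val k))).
  by rewrite scale1r.
by move=> l; rewrite scale0r.
Qed.

HB.instance Definition _ i :=
  GRing.isLinear.Build C F F *:%R (op_t i) (fock_ext_linear _).
HB.instance Definition _ i :=
  GRing.isLinear.Build C F F *:%R (op_d i) (fock_ext_linear _).
HB.instance Definition _ a :=
  GRing.isLinear.Build C F F *:%R (op_d0 a) (fock_ext_linear _).

(** The sign that [tensor_op] puts on each basis monomial, as a linear operator. *)
Definition fock_parity : F -> F :=
  fock_ext (fun k => (-1) ^+ odd_exponent k *: fmon C k).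
HB.instance Definition _ :=
  GRing.isLinear.Build C F F *:%R fock_parity (fock_ext_linear _).

Lemma fockU (c : C) (k : monomial) : << c *g k >> = c *: << k >> :> F.
Proof.
apply/malgP => l; rewrite [LHS]mcoeffU [RHS]mcoeffZ mcoeffU.
by rewrite mulrnAr mulr1.
Qed.

Lemma fock_linear_ext (W : lmodType C) (f f' : {linear F -> W}) :
  (forall k : monomial, f << k >> = f' << k >>) -> f =1 f'.
Proof.
move=> ff' x; rewrite (monalgE x) !linear_sum; apply: eq_bigr => k _.
by rewrite fockU !linearZ ff'.
Qed.

Lemma fmonU (k : monomial) : fmon C (val k) = << k >>.
Proof. by rewrite /fmon valK. Qed.

Lemma fmon_notin k : ~~ admissible k -> fmon C k = 0.
Proof. by move=> nk; rewrite /fmon insubN. Qed.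

Lemma sum_incr (P : pred I) i k :
  (\sum_(j | P j) incr i k j = \sum_(j | P j) k j + P i)%N.
Proof.
under eq_bigr do rewrite ffunE.
rewrite big_split /= -big_mkcondr /=; congr (_ + _)%N.
by rewrite sum1_card (eq_card (B := [pred j | P j && (j == i)])) //= -sum1_card
  /= big_mkcondl /= big_pred1_eq; case: (P i).
Qed.

Lemma incrC i j k : incr i (incr j k) = incr j (incr i k).
Proof. by apply/ffunP => l; rewrite !ffunE addnAC. Qed.

Lemma incrK i : cancel (@incr m n i) (decr i).
Proof. by move=> k; apply/ffunP => l; rewrite !ffunE addnK. Qed.

Lemma decrK i k : (0 < k i)%N -> incr i (decr i k) = k.
Proof.
move=> ki; apply/ffunP => l; rewrite !ffunE subnK //.
by case: eqP => // ->.
Qed.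

Lemma admissible_decr i k : admissible k -> admissible (decr i k).
Proof.
move=> /forallP ak; apply/forallP => j; apply/implyP => bj.
by rewrite ffunE (leq_trans (leq_subr _ _)) // (implyP (ak j)).
Qed.

Lemma admissible_incr i k :
  admissible k -> admissible (incr i k) = ~~ (bar i && (k i != 0)%N).
Proof.
move=> /forallP ak; apply/forallP/idP => [/(_ i)|h j].
  by rewrite ffunE eqxx addn1 ltnS leqn0; case: (bar i) => //= /eqP ->.
apply/implyP => bj; rewrite ffunE.
case: (j =P i) => [ji|_]; last by rewrite addn0 (implyP (ak j)).
by move: h; rewrite ji -{1}ji bj /= negbK => /eqP ->.
Qed.

Lemma admissible_incrW i k : admissible (incr i k) -> admissible k.
Proof. by move=> /(admissible_decr i); rewrite incrK. Qed.

Lemma move_sign_incr i j k :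
  move_sign C i (incr j k) =
    (-1) ^+ [&& bar i, bar j & (j < i)%N] * move_sign C i k.
Proof.
rewrite /move_sign sum_incr oddD oddb -signr_addb.
by case: (bar i); rewrite //= addbC.
Qed.

Lemma odd_exponent_incr i k :
  odd_exponent (incr i k) = odd_exponent k (+) bar i.
Proof. by rewrite /odd_exponent sum_incr oddD oddb. Qed.

Lemma op_t_fmon i k :
  op_t i (fmon C k) = move_sign C i k *: fmon C (incr i k).
Proof.
have [ak|nk] := boolP (admissible k).
  by have := fock_extU (fun k => move_sign C i k *: fmon C (incr i k))
    (Sub k ak); rewrite -fmonU SubK.
rewrite !fmon_notin ?linear0 ?scaler0 //.
by apply: contra nk => /admissible_incrW.
Qed.

Lemma op_d0_fmon a k : op_d0 a (fmon C k) = (a - (\sum_i k i)%:R) *: fmon C k.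
Proof.
have [ak|nk] := boolP (admissible k).
  by have := fock_extU (fun k => (a - (\sum_i k i)%:R) *: fmon C k)
    (Sub k ak); rewrite -fmonU SubK.
by rewrite !fmon_notin ?linear0 ?scaler0.
Qed.

Lemma fock_parity_fmon k :
  fock_parity (fmon C k) = (-1) ^+ odd_exponent k *: fmon C k.
Proof.
have [ak|nk] := boolP (admissible k).
  by have := fock_extU (fun k => (-1) ^+ odd_exponent k *: fmon C k)
    (Sub k ak); rewrite -fmonU SubK.
by rewrite !fmon_notin ?linear0 ?scaler0.
Qed.

(* Inadmissible exponents are excluded: there [fmon] is zero, while lowering  *)
(* such an exponent may give back an admissible one.                          *)
Lemma op_d_fmon i k : admissible k ->
  op_d i (fmon C k) = (move_sign C i k * (k i)%:R) *: fmon C (decr i k).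
Proof.
move=> ak; have := fock_extU (fun k =>
  (move_sign C i k * (k i)%:R) *: fmon C (decr i k)) (Sub k ak).
by rewrite -fmonU SubK.
Qed.

Lemma op_d_fmon0 i k : k i = 0%N -> op_d i (fmon C k) = 0.
Proof.
have [ak|nk] := boolP (admissible k); last by rewrite fmon_notin ?linear0.
by move=> ki; rewrite op_d_fmon // ki mulr0 scale0r.
Qed.

Lemma move_sign_incrr i k : move_sign C i (incr i k) = move_sign C i k.
Proof. by rewrite move_sign_incr ltnn !andbF mul1r. Qed.

Lemma op_d_fmon_incr i k : admissible (incr i k) ->
  op_d i (fmon C (incr i k)) = (move_sign C i k * (k i).+1%:R) *: fmon C k.
Proof.
move=> ak; rewrite (op_d_fmon i ak) incrK move_sign_incrr.
by rewrite [incr i k i]ffunE eqxx addn1.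
Qed.

Lemma move_sign_sqr i k : move_sign C i k * move_sign C i k = 1.
Proof. by rewrite /move_sign -signr_addb addbb. Qed.

(** Exactly one of i < j and j < i holds, so exactly one of the two orders picks up an extra sign,
    and only if both indices are odd. *)
Lemma move_signC i j k : i != j ->
  move_sign C j k * move_sign C i (incr j k) =
    (-1) ^+ (bar i && bar j) * (move_sign C i k * move_sign C j (incr i k)).
Proof.
move=> ij; rewrite !move_sign_incr /move_sign -!signr_addb; congr (_ ^+ _).
have : (i : nat) != j by rewrite val_eqE.
case: ltngtP => // _ _; case: (bar i); case: (bar j) => //=;
  by case: (odd _); case: (odd _).
Qed.

(** The same count, in the form that occurs when a derivative passes a variable in [op_dt]. *)
Lemma move_sign_incrC i j k : i != j ->
  move_sign C j (incr i k) * move_sign C i (incr j k) =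
    (-1) ^+ (bar i && bar j) * (move_sign C i k * move_sign C j k).
Proof.
move=> ij; rewrite !move_sign_incr /move_sign -!signr_addb; congr (_ ^+ _).
have : (i : nat) != j by rewrite val_eqE.
case: ltngtP => // _ _; case: (bar i); case: (bar j) => //=;
  by case: (odd _); case: (odd _).
Qed.

Lemma op_tC i j x :
  op_t i (op_t j x) = (-1) ^+ (bar i && bar j) *: op_t j (op_t i x).
Proof.
move: x; apply: (@fock_linear_ext F (op_t i \o op_t j)
  ((-1) ^+ (bar i && bar j) \*: (op_t j \o op_t i))) => k /=.
rewrite -fmonU !op_t_fmon !linearZ /= !op_t_fmon !scalerA incrC.
have [->|ij] := eqVneq i j; last first.
  by f_equal; rewrite (move_signC (val k) ij) -mulrA [RHS]mulrCA.
case: (boolP (bar j)) => [bj|_]; last first.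
  by f_equal; rewrite mulr1.
(* For odd j the square of t_j is zero: the exponent of t_j would be at least 2. *)
rewrite fmon_notin ?scaler0 //; apply/negP => /forallP/(_ j).
by rewrite bj !ffunE eqxx !addn1.
Qed.

Lemma op_dC i j x :
  op_d i (op_d j x) = (-1) ^+ (bar i && bar j) *: op_d j (op_d i x).
Proof.
move: x; apply: (@fock_linear_ext F (op_d i \o op_d j)
  ((-1) ^+ (bar i && bar j) \*: (op_d j \o op_d i))) => k /=.
rewrite -fmonU; have ak := valP k; move: (val k) ak => {}k ak.
have [->|ij] := eqVneq i j.
  case: (boolP (bar j)) => [bj|_]; last by rewrite scale1r.
  rewrite (op_d_fmon j ak) linearZ /= (@op_d_fmon0 j (decr j k)).
    by rewrite !scaler0.
  have := implyP (forallP ak j) bj; rewrite ffunE eqxx.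
  by case: (k j) => [|[]].
have d0 i1 j1 : i1 != j1 -> k i1 = 0%N -> op_d i1 (op_d j1 (fmon C k)) = 0.
  move=> ne k0; rewrite (op_d_fmon j1 ak) linearZ /=.
  by rewrite (@op_d_fmon0 i1 (decr j1 k)) ?scaler0 // ffunE k0.
have [ki|ki] := posnP (k i).
  by rewrite (d0 i j ij ki) (op_d_fmon0 ki) linear0 scaler0.
have [kj|kj] := posnP (k j).
  by rewrite (d0 j i _ kj) 1?eq_sym // (op_d_fmon0 kj) linear0 scaler0.
(* Both exponents are positive, so k is rewritten as a twice raised exponent, which removes the
   truncated subtraction of [decr]. *)
move: ak; rewrite -(decrK kj) -(@decrK i (decr j k)); last first.
  by rewrite ffunE (negPf ij) subn0.
move: (decr i (decr j k)) => {ki kj d0}k ak.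
have ak' : admissible (incr i (incr j k)) by rewrite incrC.
rewrite (op_d_fmon_incr ak) linearZ /= (op_d_fmon_incr (admissible_incrW ak)).
rewrite incrC (op_d_fmon_incr ak') [op_d j (_ *: _)]linearZ /=.
rewrite (op_d_fmon_incr (admissible_incrW ak')) !scalerA; f_equal.
have -> : incr i k j = k j by rewrite ffunE eq_sym (negPf ij) addn0.
have -> : incr j k i = k i by rewrite ffunE (negPf ij) addn0.
rewrite mulrACA -[RHS]mulrA [in RHS]mulrACA (mulrC (move_sign C i (incr j k))).
rewrite (move_signC k ij) -[in RHS]mulrA signrMK.
by congr (_ * _); rewrite mulrC.
Qed.

Lemma op_dt i j x :
  op_d i (op_t j x) = (i == j)%:R *: x
    + (-1) ^+ (bar i && bar j) *: op_t j (op_d i x).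
Proof.
move: x; apply: (@fock_linear_ext F (op_d i \o op_t j)
  (((i == j)%:R \*: idfun) \+
    ((-1) ^+ (bar i && bar j) \*: (op_t j \o op_d i)))) => k /=.
rewrite -fmonU; have ak := valP k; move: (val k) ak => {}k ak.
rewrite op_t_fmon linearZ /= (op_d_fmon i ak) linearZ /= op_t_fmon.
have [->|ij] := eqVneq i j.
  have [aj|nj] := boolP (admissible (incr j k)).
    rewrite (op_d_fmon_incr aj) scale1r !scalerA mulrA move_sign_sqr mul1r.
    have [kj|kj] := posnP (k j).
      by rewrite kj !(mulr0, mul0r) scale0r addr0 scale1r.
    rewrite (decrK kj) -[fmon C k in X in _ = X + _]scale1r -scalerDl.
    have -> : move_sign C j (decr j k) = move_sign C j k.
      by rewrite -{2}(decrK kj) move_sign_incrr.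
    rewrite -mulrA mulrAC move_sign_sqr mul1r andbb.
    move: aj; rewrite (admissible_incr _ ak) -lt0n kj andbT => /negPf ->.
    by rewrite mul1r -nat1r.
  (* Here j is odd and k_j = 1: t_j kills the monomial while t_j d_j fixes it, so the two terms on
     the right cancel. *)
  rewrite (fmon_notin nj) linear0 scaler0 scale1r.
  move: nj; rewrite (admissible_incr _ ak) negbK => /andP[bj kj].
  have k1 : k j = 1%N.
    by have := implyP (forallP ak j) bj; case: (k j) kj => [|[]].
  rewrite decrK ?k1 // bj !scalerA /=.
  have -> : move_sign C j (decr j k) = move_sign C j k.
    by rewrite -[in RHS](@decrK j k) ?k1 // move_sign_incrr.
  by rewrite mulr1 -mulrA move_sign_sqr mulr1 scaleN1r subrr.
rewrite scale0r add0r.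
have [ki|ki] := posnP (k i).
  rewrite ki mulr0 scale0r scaler0 (@op_d_fmon0 i (incr j k)) ?scaler0 //.
  by rewrite ffunE ki (negPf ij).
rewrite -(decrK ki) in ak *; move: (decr i k) ak => {ki}k ak.
rewrite !incrK.
have [aj|nj] := boolP (admissible (incr j (incr i k))); last first.
  rewrite (fmon_notin nj) linear0 scaler0.
  rewrite (@fmon_notin (incr j k)) ?scaler0 //.
  move: nj; rewrite (admissible_incr _ ak).
  by rewrite (admissible_incr _ (admissible_incrW ak)) ffunE [j == i]eq_sym
    (negPf ij) addn0.
rewrite incrC in aj *; rewrite (op_d_fmon_incr aj) !scalerA; f_equal.
rewrite ![incr _ _ i]ffunE eqxx (negPf ij) addn0 addn1 move_sign_incrr.
rewrite mulrA (move_sign_incrC k ij) -[RHS]mulrA [X in _ = _ * X]mulrAC.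
by rewrite !mulrA.
Qed.

Lemma op_d0_t a i x : op_d0 a (op_t i x) = op_t i (op_d0 a x) - op_t i x.
Proof.
move: x; apply: (@fock_linear_ext F (op_d0 a \o op_t i)
  ((op_t i \o op_d0 a) \- op_t i)) => k /=.
rewrite -fmonU !op_d0_fmon !linearZ /= !op_t_fmon linearZ /= op_d0_fmon.
rewrite !scalerA -scalerBl; f_equal.
by rewrite sum_incr natrD opprD addrA mulrDr mulrN1 [in RHS]mulrC.
Qed.

Lemma op_d0_d a i x : op_d0 a (op_d i x) = op_d i (op_d0 a x) + op_d i x.
Proof.
move: x; apply: (@fock_linear_ext F (op_d0 a \o op_d i)
  ((op_d i \o op_d0 a) \+ op_d i)) => k /=.
rewrite -fmonU; have ak := valP k; move: (val k) ak => {}k ak.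
rewrite op_d0_fmon [op_d i (_ *: _)]linearZ /=.
have [ki|ki] := posnP (k i).
  by rewrite (op_d_fmon0 ki) linear0 scaler0 addr0.
rewrite -(decrK ki) in ak *; move: (decr i k) ak => {ki}k ak.
rewrite (op_d_fmon_incr ak) linearZ /= op_d0_fmon !scalerA -scalerDl; f_equal.
rewrite sum_incr natrD opprD addrA [in RHS]mulrBl mul1r subrK.
exact: mulrC.
Qed.

Lemma fock_parityK : involutive (@fock_parity).
Proof.
apply: (@fock_linear_ext F (fock_parity \o fock_parity) idfun) => k /=.
by rewrite -fmonU fock_parity_fmon linearZ /= fock_parity_fmon scalerA
  -signr_addb addbb scale1r.
Qed.

Lemma fock_parity_t i x :
  fock_parity (op_t i x) = (-1) ^+ bar i *: op_t i (fock_parity x).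
Proof.
move: x; apply: (@fock_linear_ext F (fock_parity \o op_t i)
  ((-1) ^+ bar i \*: (op_t i \o fock_parity))) => k /=.
rewrite -fmonU op_t_fmon fock_parity_fmon !linearZ /= fock_parity_fmon.
rewrite op_t_fmon !scalerA odd_exponent_incr signr_addb; f_equal.
exact: mulrC.
Qed.

Lemma fock_parity_d i x :
  fock_parity (op_d i x) = (-1) ^+ bar i *: op_d i (fock_parity x).
Proof.
move: x; apply: (@fock_linear_ext F (fock_parity \o op_d i)
  ((-1) ^+ bar i \*: (op_d i \o fock_parity))) => k /=.
rewrite -fmonU; have ak := valP k; move: (val k) ak => {}k ak.
rewrite fock_parity_fmon [op_d i (_ *: _)]linearZ /=.
have [ki|ki] := posnP (k i).
  by rewrite (op_d_fmon0 ki) linear0 !scaler0.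
rewrite -(decrK ki) in ak *; move: (decr i k) ak => {ki}k ak.
rewrite (op_d_fmon_incr ak) linearZ /= fock_parity_fmon !scalerA; f_equal.
rewrite odd_exponent_incr signr_addb [X in _ = X * _]mulrCA.
by rewrite -signr_addb addbb mulr1 mulrC.
Qed.

Lemma fock_parity_d0 a x : fock_parity (op_d0 a x) = op_d0 a (fock_parity x).
Proof.
move: x; apply: (@fock_linear_ext F (fock_parity \o op_d0 a)
  (op_d0 a \o fock_parity)) => k /=.
rewrite -fmonU op_d0_fmon fock_parity_fmon !linearZ /= fock_parity_fmon.
by rewrite op_d0_fmon !scalerA; f_equal; rewrite mulrC.
Qed.

Lemma euler_linear a : linear (@euler C m n a).
Proof.
move=> c x y; rewrite /euler linearP scalerDr addrACA; congr (_ + _).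
rewrite scaler_sumr -big_split; apply: eq_bigr => i _.
by rewrite !linearP.
Qed.
HB.instance Definition _ a :=
  GRing.isLinear.Build C F F *:%R (euler a) (euler_linear a).

(** On a monomial each t_i d_i gives k_i, and t_0 d_0 gives a minus the sum of the k_i. *)
Lemma eulerE a x : euler a x = a *: x.
Proof.
move: x; apply: (@fock_linear_ext F (euler a) (a \*: idfun)) => k /=.
rewrite -fmonU; have ak := valP k; move: (val k) ak => {}k ak.
rewrite /euler op_d0_fmon (eq_bigr (fun i => (k i)%:R *: fmon C k)) => [|i _].
  by rewrite -scaler_suml -scalerDl -natr_sum subrK.
have [ki|ki] := posnP (k i).
  by rewrite (op_d_fmon0 ki) linear0 ki scale0r.
rewrite -(decrK ki) in ak *; move: (decr i k) ak => {ki}k ak.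
rewrite (op_d_fmon_incr ak) linearZ /= op_t_fmon scalerA; f_equal.
by rewrite mulrAC move_sign_sqr mul1r ffunE eqxx addn1.
Qed.

End FockSpace.

(** * The tensor product of the Fock space with a module, and the sign rule *)

Section Tensor.
Variables (C : fieldType) (m n : nat) (V : lmodType C).
Local Notation I := 'I_(m + n).
Local Notation F := (fock C m n).
Local Notation exponent := (exponent m n).
Local Notation monomial := (monomial m n).
Local Notation T := (fock_tensor m n V).
Implicit Types (x y : F) (v : V) (w : T).

Lemma tensor_scaleE c w k : (c *: w)@_k = c *: w@_k.
Proof. exact: vm_scaleE. Qed.

Lemma tensorU_linear (k : monomial) : linear (fun v : V => << v *g k >> : T).
Proof.
move=> c u v; apply/malgP => l; rewrite [RHS]mcoeffD.
rewrite [X in _ = X + _]tensor_scaleE.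
transitivity ((c *: u + v) *+ (k == l)); first exact: mcoeffU.
rewrite mulrnDl scalerMnr; f_equal; last by symmetry; exact: mcoeffU.
by f_equal; symmetry; exact: mcoeffU.
Qed.

Lemma pure_linear_l v : linear (fun x : F => pure x v).
Proof.
move=> c x y.
apply: (msum_linear (F := fun (k : monomial) (b : C) => << b *: v *g k >> : T)).
  by move=> k; rewrite scale0r monalgU0.
move=> k; rewrite mcoeffD mcoeffZ scalerDl -scalerA.
exact: tensorU_linear.
Qed.

Lemma pure_linear_r x : linear (@pure C m n V x).
Proof.
move=> c u v; rewrite scaler_sumr -big_split; apply: eq_bigr => k _ /=.
by rewrite -tensorU_linear scalerDr !scalerA mulrC.
Qed.

Lemma pureU (k : monomial) v : pure << k >> v = << v *g k >>.
Proof.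
rewrite [LHS](msumU (F := fun (k : monomial) (b : C) => << b *: v *g k >> : T)).
  by rewrite scale1r.
by move=> l; rewrite scale0r monalgU0.
Qed.

HB.instance Definition _ x :=
  GRing.isLinear.Build C V T *:%R (pure x) (pure_linear_r x).

Definition purel v : F -> T := fun x => pure x v.
HB.instance Definition _ v :=
  GRing.isLinear.Build C F T *:%R (purel v) (pure_linear_l v).

Lemma tensor_linear_ext (W : lmodType C) (f f' : {linear T -> W}) :
  (forall x v, f (pure x v) = f' (pure x v)) -> f =1 f'.
Proof.
move=> ff' w; rewrite (monalgE w) !linear_sum; apply: eq_bigr => k _.
by rewrite -pureU.
Qed.

Lemma tensor_op_linear p (A : F -> F) (B : {linear V -> V}) :
  linear (@tensor_op C m n V p A B).
Proof.
move=> c u w.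
apply: (msum_linear (F := fun (k : monomial) (v : V) =>
  (-1) ^+ (p && odd_exponent (val k)) *: pure (A << k >>) (B v))).
  by move=> k; rewrite linear0 linear0 scaler0.
move=> k; rewrite mcoeffD tensor_scaleE !linearP.
reflexivity.
Qed.
HB.instance Definition _ p (A : F -> F) (B : {linear V -> V}) :=
  GRing.isLinear.Build C T T *:%R (tensor_op p A B) (tensor_op_linear p A B).

Definition parity_pow (p : bool) : F -> F :=
  if p then @fock_parity C m n else id.

Lemma parity_pow_linear p : linear (parity_pow p).
Proof. by case: p => [|//]; exact: linearP. Qed.
HB.instance Definition _ p :=
  GRing.isLinear.Build C F F *:%R (parity_pow p) (parity_pow_linear p).

(** With the sign absorbed into [parity_pow p], the sign rule holds for every [x], homogeneous or
    not. *)
Lemma tensor_op_pure p (A : {linear F -> F}) (B : {linear V -> V}) x v :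
  tensor_op p A B (pure x v) = pure (A (parity_pow p x)) (B v).
Proof.
move: x; apply: (@fock_linear_ext C m n T (tensor_op p A B \o purel v)
  (purel (B v) \o (A \o parity_pow p))) => k /=.
rewrite {1}/purel pureU [LHS](msumU (F := fun (k : monomial) (v : V) =>
  (-1) ^+ (p && odd_exponent (val k)) *: pure (A << k >>) (B v))); last first.
  by move=> l; rewrite linear0 linear0 scaler0.
rewrite -!fmonU; case: p; last by rewrite scale1r.
by rewrite /= fock_parity_fmon !linearZ.
Qed.

End Tensor.

(** * Super-commutation relations *)

Section Superbracket.
Variable A : pzRingType.
Implicit Types (x y z : A) (p q : bool).

(** The supercommutator. The ring carries no grading, so the product p of the two parities is passed
    explicitly. *)
Definition sbr p x y : A := x * y - (-1) ^+ p * (y * x).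

Lemma sbrDl p x y z : sbr p (x + y) z = sbr p x z + sbr p y z.
Proof. by rewrite /sbr mulrDl mulrDr mulrDr opprD addrACA. Qed.

Lemma sbrDr p x y z : sbr p x (y + z) = sbr p x y + sbr p x z.
Proof. by rewrite /sbr mulrDl mulrDr mulrDr opprD addrACA. Qed.

Lemma sbrNl p x y : sbr p (- x) y = - sbr p x y.
Proof. by rewrite /sbr !(mulNr, mulrN) opprB opprK addrC. Qed.

Lemma sbrNr p x y : sbr p x (- y) = - sbr p x y.
Proof. by rewrite /sbr !(mulNr, mulrN) opprB opprK addrC. Qed.

Lemma sbr0l p x : sbr p 0 x = 0.
Proof. by rewrite /sbr !(mulr0, mul0r) subrr. Qed.

Lemma sbr0r p x : sbr p x 0 = 0.
Proof. by rewrite /sbr !(mulr0, mul0r) subrr. Qed.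

Lemma sbr_sumr (J : finType) p x (f : J -> A) :
  sbr p x (\sum_j f j) = \sum_j sbr p x (f j).
Proof. by apply: big_morph; [exact: sbrDr | exact: sbr0r]. Qed.

Lemma sbr_suml (J : finType) p (f : J -> A) x :
  sbr p (\sum_j f j) x = \sum_j sbr p (f j) x.
Proof.
by apply: (big_morph (fun y => sbr p y x)) => [y z|];
  [exact: sbrDl | exact: sbr0l].
Qed.

Lemma sbr_signl p q x y : sbr p ((-1) ^+ q * x) y = (-1) ^+ q * sbr p x y.
Proof. by case: q; rewrite !(mulN1r, mul1r, sbrNl). Qed.

Lemma sbr_signr p q x y : sbr p x ((-1) ^+ q * y) = (-1) ^+ q * sbr p x y.
Proof. by case: q; rewrite !(mulN1r, mul1r, sbrNr). Qed.

Lemma sbrC p x y : sbr p y x = - ((-1) ^+ p * sbr p x y).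
Proof. by rewrite /sbr mulrBr signrMK opprB. Qed.

(** Super Leibniz rule. With the parities given as bits it is an identity between arbitrary ring
    elements. *)
Lemma sbrMl (px py pz : bool) x y z :
  sbr ((px (+) py) && pz) (x * y) z =
    x * sbr (py && pz) y z + (-1) ^+ (py && pz) * (sbr (px && pz) x z * y).
Proof.
rewrite andb_addl addbC /sbr signr_addb !mulrBl !mulrBr.
have -> : x * ((-1) ^+ (py && pz) * (z * y)) = (-1) ^+ (py && pz) * (x * z * y).
  by rewrite mulrA commr_sign -!mulrA.
by rewrite addrA subrK -!mulrA.
Qed.

Lemma sbrMr (px py pz : bool) x y z :
  sbr (px && (py (+) pz)) x (y * z) =
    sbr (px && py) x y * z + (-1) ^+ (px && py) * (y * sbr (px && pz) x z).
Proof.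
rewrite andb_addr /sbr signr_addb !mulrBl !mulrBr.
have -> : (-1) ^+ (px && py) * (y * ((-1) ^+ (px && pz) * (z * x))) =
    (-1) ^+ (px && py) * (-1) ^+ (px && pz) * (y * z * x).
  by rewrite [y * (_ * _)]mulrA commr_sign -!mulrA.
by rewrite addrA -!mulrA subrK.
Qed.

End Superbracket.

(** * Compatibility of phi_R with brackets, in an abstract ring *)

Section Realization.
Variables (A : pzRingType) (m n : nat).
Local Notation I := 'I_(m + n).
Local Notation s p := ((-1) ^+ p : A).
(** These stand for t_i/t_0, t_0 d_i, t_0 d_0, R and e_ij; thus t_i d_j is [X i * D j] and t_i d_0
    is [X i * D0]. *)
Variables (X D : I -> A) (D0 z : A) (E : I -> I -> A).
Implicit Types i j k l : I.

Hypothesis XX : forall i j, sbr (bar i && bar j) (X i) (X j) = 0.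
Hypothesis DD : forall i j, sbr (bar i && bar j) (D i) (D j) = 0.
Hypothesis DX : forall i j, sbr (bar i && bar j) (D i) (X j) = (i == j)%:R.
Hypothesis D0X : forall i, sbr false D0 (X i) = - X i.
Hypothesis D0D : forall i, sbr false D0 (D i) = D i.
Hypothesis EX : forall i j k, sbr (ebar i j && bar k) (E i j) (X k) = 0.
Hypothesis ED : forall i j k, sbr (ebar i j && bar k) (E i j) (D k) = 0.
Hypothesis ED0 : forall i j, sbr false (E i j) D0 = 0.
Hypothesis EE : forall i j k l, sbr (ebar i j && ebar k l) (E i j) (E k l) =
  E i l *+ (j == k) - s (ebar i j && ebar k l) * (E k j *+ (i == l)).
Hypothesis z_central : forall x, sbr false z x = 0.

Definition gl_act i j : A :=
  X i * D j + E i j + (s (bar i && bar j) * z) *+ (i == j).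

Definition twist i : A := \sum_j s (bar i && bar j) * (X j * E i j).

Definition raise i : A := X i * D0 - twist i.

Definition phi (a b : option I) : A :=
  match a, b with
  | Some i, Some j => gl_act i j
  | Some i, None => raise i
  | None, Some j => D j
  | None, None => D0 + z
  end.

Definition obar (a : option I) : bool := if a is Some i then bar i else false.

Let XD i j :
  sbr (bar i && bar j) (X i) (D j) = - (s (bar i && bar j) *+ (i == j)).
Proof. by rewrite sbrC andbC DX eq_sym mulr_natr. Qed.

Let XE i k l : sbr (bar i && ebar k l) (X i) (E k l) = 0.
Proof. by rewrite sbrC andbC EX mulr0 oppr0. Qed.

Let XD_X i j k : sbr (ebar i j && bar k) (X i * D j) (X k) = X i *+ (j == k).
Proof. by rewrite sbrMl DX XX mul0r mulr0 addr0 mulr_natr. Qed.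

Let XD_D i j k : sbr (ebar i j && bar k) (X i * D j) (D k) =
  - (s (ebar i j && bar k) * D j *+ (i == k)).
Proof.
rewrite sbrMl DD XD mulr0 add0r mulNr mulrN mulrnAl mulrnAr mulrA -signr_addb.
by rewrite /ebar; case: (bar i); case: (bar j); case: (bar k).
Qed.

Let XD_D0 i j : sbr false (X i * D j) D0 = 0.
Proof.
rewrite (@sbrMl _ false false false) /= (sbrC _ D0 (D j)) (sbrC _ D0 (X i)).
by rewrite D0X D0D !mul1r opprK mulrN addNr.
Qed.

Let XD_XD i j k l : sbr (ebar i j && ebar k l) (X i * D j) (X k * D l) =
  X i * D l *+ (j == k) - s (ebar i j && ebar k l) * (X k * D j *+ (i == l)).
Proof.
rewrite [in LHS]/(ebar k l) sbrMr XD_X XD_D mulrnAl !mulrN; congr (_ - _).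
rewrite !mulrnAr; congr (_ *+ _).
rewrite [X k * _]mulrA commr_sign -mulrA mulrA -signr_addb.
by rewrite /ebar; case: (bar i); case: (bar j); case: (bar k); case: (bar l).
Qed.

Let XD_E i j k l : sbr (ebar i j && ebar k l) (X i * D j) (E k l) = 0.
Proof.
rewrite sbrMl (sbrC _ (E k l) (D j)) (sbrC _ (E k l) (X i)).
rewrite ![_ && ebar k l]andbC ED EX.
by rewrite !(mulr0, mul0r, oppr0, add0r).
Qed.

Let E_XD i j k l : sbr (ebar i j && ebar k l) (E i j) (X k * D l) = 0.
Proof. by rewrite sbrC andbC XD_E mulr0 oppr0. Qed.

Let sbr_zr (p : bool) x : sbr false x (s p * z) = 0.
Proof. by rewrite sbr_signr sbrC z_central mulr0 oppr0 mulr0. Qed.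

Let sbr_zl (p : bool) x : sbr false (s p * z) x = 0.
Proof. by rewrite sbr_signl z_central mulr0. Qed.

(** The first two summands of [gl_act] are supercommuting realizations of gl(m|n). The third is the
    supertrace times a central element, and the supertrace vanishes on brackets. *)
Lemma gl_act_bracket i j k l :
  sbr (ebar i j && ebar k l) (gl_act i j) (gl_act k l) =
  gl_act i l *+ (j == k) - s (ebar i j && ebar k l) * (gl_act k j *+ (i == l)).
Proof.
have zr b x : sbr (b && ebar k l) x ((s (bar k && bar l) * z) *+ (k == l)) = 0.
  case: eqP => [->|_]; last exact: sbr0r.
  by rewrite /ebar addbb andbF sbr_zr.
have zl b x : sbr (ebar i j && b) ((s (bar i && bar j) * z) *+ (i == j)) x = 0.
  case: eqP => [->|_]; last exact: sbr0l.
  by rewrite /ebar addbb andFb sbr_zl.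
rewrite /gl_act 2!sbrDl zl 4!sbrDr !zr XD_XD XD_E E_XD EE !(addr0, add0r).
rewrite !mulrnDl !mulrDr !opprD.
(* The two central terms on the right occur only when j = k and i = l, and then they cancel. *)
set z1 := (_ *+ _ *+ (j == k)); set z2 := (_ * (_ *+ _ *+ (i == l))).
have <- : z1 = z2.
  rewrite /z1 /z2 [k == j]eq_sym; case: eqP => [->|_]; last first.
    by rewrite mul0rn !mulr0n mulr0.
  case: eqP => [->|_]; last by rewrite !mulr0n mulr0.
  rewrite !mulr1n mulrA -signr_addb /ebar.
  by case: (bar k); case: (bar l).
by rewrite [RHS]addrACA subrr addr0 addrACA.
Qed.

Let X_twist i k : sbr (bar i && bar k) (X i) (twist k) = 0.
Proof.
rewrite sbr_sumr big1 // => j _; rewrite sbr_signr.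
have -> : bar i && bar k = bar i && (bar j (+) ebar k j).
  by rewrite /ebar; case: (bar j); case: (bar k).
by rewrite sbrMr XX XE !(mulr0, mul0r, addr0).
Qed.

Let D0_twist i : sbr false D0 (twist i) = - twist i.
Proof.
rewrite sbr_sumr -sumrN; apply: eq_bigr => j _.
rewrite sbr_signr (@sbrMr _ false false false) D0X (sbrC _ (E i j)) ED0.
by rewrite !(mulr0, oppr0, addr0, mulNr, mulrN).
Qed.

Let XD_twist i j k :
  sbr (ebar i j && bar k) (X i * D j) (twist k) =
    s (bar k && bar j) * (X i * E k j).
Proof.
rewrite sbr_sumr (bigD1 j) //= big1 ?addr0 => [|l lj]; rewrite sbr_signr.
  have -> : ebar i j && bar k = ebar i j && (bar j (+) ebar k j).
    by rewrite /ebar; case: (bar j); case: (bar k); case: (bar i).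
  by rewrite sbrMr XD_X XD_E eqxx !mulr0 addr0.
have -> : ebar i j && bar k = ebar i j && (bar l (+) ebar k l).
  by rewrite /ebar; case: (bar l); case: (bar k).
by rewrite sbrMr XD_X XD_E eq_sym (negPf lj) !(mul0r, mulr0, addr0).
Qed.

(** The last term, which keeps [twist] from transforming like a vector, is cancelled by [XD_twist]
    in [gl_act_raise]. *)
Let E_twist i j k :
  sbr (ebar i j && bar k) (E i j) (twist k) =
    twist i *+ (j == k) - s (bar k && bar j) * (X i * E k j).
Proof.
have h l : sbr (ebar i j && bar k) (E i j) (X l * E k l) =
    s (ebar i j && bar l) * (X l * (E i l *+ (j == k) -
      s (ebar i j && ebar k l) * (E k j *+ (i == l)))).
  have -> : ebar i j && bar k = ebar i j && (bar l (+) ebar k l).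
    by rewrite /ebar; case: (bar l); case: (bar k).
  by rewrite sbrMr EX EE mul0r add0r.
rewrite sbr_sumr; under eq_bigr do rewrite sbr_signr h mulrBr mulrBr mulrBr.
rewrite sumrB; congr (_ - _).
  rewrite -sumrMnl; apply: eq_bigr => l _.
  case: eqP => [->|_]; last by rewrite !mulr0n !mulr0.
  rewrite !mulr1n mulrA -signr_addb /ebar.
  by case: (bar i); case: (bar k); case: (bar l).
rewrite (bigD1 i) //= big1 ?addr0 => [|l li]; last first.
  by rewrite eq_sym (negPf li) mulr0n !mulr0.
rewrite eqxx mulr1n [X i * _]mulrA commr_sign -mulrA !mulrA -!signr_addb /ebar.
by case: (bar i); case: (bar j); case: (bar k).
Qed.

Let D_twist i l : sbr (bar i && bar l) (twist i) (D l) = - E i l.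
Proof.
rewrite sbr_suml (bigD1 l) //= big1 ?addr0 => [|j jl]; rewrite sbr_signl.
  have -> : bar i && bar l = (bar l (+) ebar i l) && bar l.
    by rewrite /ebar; case: (bar i); case: (bar l).
  rewrite sbrMl ED XD eqxx mulr1n mulr0 add0r mulNr !mulrN !mulrA -!signr_addb.
  by rewrite /ebar; case: (bar i); case: (bar l); rewrite mul1r.
have -> : bar i && bar l = (bar j (+) ebar i j) && bar l.
  by rewrite /ebar; case: (bar i); case: (bar j).
by rewrite sbrMl ED XD (negPf jl) mulr0n oppr0 !(mul0r, mulr0, addr0).
Qed.

(** The twists do not supercommute; in [raise_raise] the two terms found here cancel those which
    [XD0_twist] produces from the mixed brackets. *)
Let twist_twist i k : sbr (bar i && bar k) (twist i) (twist k) =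
  s (bar i && bar k) * (X k * twist i) - X i * twist k.
Proof.
have h j : sbr (bar i && bar k) (X j * E i j) (twist k) =
    X j * twist i *+ (j == k) - s (bar k && bar j) * (X j * (X i * E k j)).
  have -> : bar i && bar k = (bar j (+) ebar i j) && bar k.
    by rewrite /ebar; case: (bar i); case: (bar j).
  rewrite sbrMl E_twist X_twist mul0r mulr0 addr0 mulrBr mulrnAr.
  by rewrite [X j * (_ * _)]mulrA commr_sign -mulrA.
rewrite [in LHS]/(twist i) sbr_suml.
under eq_bigr do rewrite sbr_signl h mulrBr.
rewrite sumrB; congr (_ - _).
  rewrite (bigD1 k) //= big1 ?addr0 => [|j jk]; first by rewrite eqxx mulr1n.
  by rewrite (negPf jk) mulr0n mulr0.
rewrite mulr_sumr; apply: eq_bigr => j _.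
have -> : X j * (X i * E k j) = s (bar i && bar j) * (X i * (X j * E k j)).
  have /eqP := XX j i; rewrite /sbr subr_eq0 andbC => /eqP e.
  by rewrite mulrA e -!mulrA.
rewrite [RHS]mulrA [X i * s _]commr_sign -[RHS]mulrA mulrA mulrA -!signr_addb.
by congr (_ * _); case: (bar i); case: (bar j); case: (bar k).
Qed.

Let XD0_X i k : sbr (bar i && bar k) (X i * D0) (X k) = - (X i * X k).
Proof.
have := @sbrMl _ (bar i) false (bar k) (X i) D0 (X k).
by rewrite addbF => ->; rewrite D0X XX mul0r mulr0 addr0 mulrN.
Qed.

Let XD0_D0 i : sbr false (X i * D0) D0 = X i * D0.
Proof.
have := @sbrMl _ false false false (X i) D0 D0.
rewrite [_ && _]/= => ->; rewrite {1}/sbr expr0 mul1r subrr mulr0 add0r mul1r.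
by rewrite sbrC D0X mul1r opprK.
Qed.

Let XD0_twist i k :
  sbr (bar i && bar k) (X i * D0) (twist k) = - (X i * twist k).
Proof.
have := @sbrMl _ (bar i) false (bar k) (X i) D0 (twist k).
by rewrite addbF => ->; rewrite D0_twist X_twist mul0r mulr0 addr0 mulrN.
Qed.

Lemma gl_act_raise i j k :
  sbr (ebar i j && bar k) (gl_act i j) (raise k) = raise i *+ (j == k).
Proof.
have zl x :
    sbr (ebar i j && bar k) ((s (bar i && bar j) * z) *+ (i == j)) x = 0.
  case: eqP => [->|_]; last exact: sbr0l.
  by rewrite /ebar addbb andFb sbr_zl.
rewrite /gl_act /raise !sbrDl zl !sbrDr !sbrNr XD_twist E_twist.
have h x (y : A) : sbr (ebar i j && bar k) x (X k * D0) =
    sbr (ebar i j && bar k) x (X k) * D0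
      + s (ebar i j && bar k) * (X k * sbr false x D0).
  have := @sbrMr _ (ebar i j) (bar k) false x (X k) D0.
  by rewrite addbF andbF.
rewrite !h // XD_X EX XD_D0 ED0 !(mulr0, mul0r, addr0, add0r) opprB.
by rewrite addrA addrNK mulrnAl mulrnBl.
Qed.

Lemma gl_act_D i j l :
  sbr (ebar i j && bar l) (gl_act i j) (D l) =
    - (s (ebar i j && bar l) * (D j *+ (i == l))).
Proof.
have zl x :
    sbr (ebar i j && bar l) ((s (bar i && bar j) * z) *+ (i == j)) x = 0.
  case: eqP => [->|_]; last exact: sbr0l.
  by rewrite /ebar addbb andFb sbr_zl.
by rewrite /gl_act !sbrDl zl ED !addr0 XD_D mulrnAr.
Qed.

Lemma gl_act_D0 i j : sbr false (gl_act i j) (D0 + z) = 0.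
Proof.
have zl x : sbr false ((s (bar i && bar j) * z) *+ (i == j)) x = 0.
  by case: eqP => [->|_]; [rewrite sbr_zl | exact: sbr0l].
have zr x : sbr false x z = 0 by rewrite sbrC z_central mulr0 oppr0.
by rewrite /gl_act sbrDr zr !sbrDl zl ED0 XD_D0 !addr0.
Qed.

Lemma raise_raise i k : sbr (bar i && bar k) (raise i) (raise k) = 0.
Proof.
rewrite /raise sbrDl sbrNl !sbrDr !sbrNr XD0_twist twist_twist.
have -> : sbr (bar i && bar k) (X i * D0) (X k * D0) = 0.
  have := @sbrMr _ (bar i) (bar k) false (X i * D0) (X k) D0.
  rewrite addbF => ->; rewrite XD0_X andbF XD0_D0 mulNr.
  have /eqP := XX i k; rewrite /sbr subr_eq0 => /eqP e.
  by rewrite e [X k * (_ * _)]mulrA !mulrA addNr.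
rewrite (sbrC _ (X k * D0)) andbC XD0_twist mulrN opprK.
by rewrite add0r opprK subKr subrr.
Qed.

(** The t_i d_l part comes from [X i * D0] and the e_il part from [twist]; for i = l the copies of z
    in [gl_act] and in [D0 + z] cancel. *)
Lemma raise_D i l : sbr (bar i && bar l) (raise i) (D l) =
  gl_act i l - s (bar i && bar l) * ((D0 + z) *+ (i == l)).
Proof.
rewrite /raise sbrDl sbrNl D_twist opprK.
have := @sbrMl _ (bar i) false (bar l) (X i) D0 (D l).
rewrite addbF => ->; rewrite D0D expr0 mul1r XD mulNr mulrnAl.
rewrite /gl_act -mulrnAr.
rewrite [X in _ = _ - X]mulrnAr mulrDr mulrnDl opprD [RHS]addrACA subrr addr0.
by rewrite addrAC mulrnAr.
Qed.

Lemma raise_D0 i : sbr false (raise i) (D0 + z) = raise i.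
Proof.
rewrite sbrDr (sbrC _ z) z_central mulr0 oppr0 addr0.
by rewrite /raise sbrDl sbrNl XD0_D0 (sbrC _ D0) D0_twist mul1r opprK.
Qed.

Lemma D_D0 l : sbr false (D l) (D0 + z) = - D l.
Proof.
by rewrite sbrDr (sbrC _ z) z_central (sbrC _ D0) D0D mulr0 oppr0 addr0 mul1r.
Qed.

Let phi_bracket_spec (a b c d : option I) :=
  let p := (obar a (+) obar b) && (obar c (+) obar d) in
  sbr p (phi a b) (phi c d) =
    phi a d *+ (b == c) - s p * (phi c b *+ (a == d)).

(** Super-antisymmetry: six of the sixteen cases below reduce to six others. *)
Let phi_bracketC a b c d : phi_bracket_spec c d a b -> phi_bracket_spec a b c d.
Proof.
rewrite /phi_bracket_spec /= => h; rewrite sbrC andbC h mulrBr signrMK opprB.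
by rewrite [d == a]eq_sym [c == b]eq_sym.
Qed.

Lemma phi_bracket a b c d :
  let p := (obar a (+) obar b) && (obar c (+) obar d) in
  sbr p (phi a b) (phi c d) =
    phi a d *+ (b == c) - s p * (phi c b *+ (a == d)).
Proof.
suff : phi_bracket_spec a b c d by [].
have D0D0 : sbr false (D0 + z) (D0 + z) = 0 by rewrite /sbr mul1r subrr.
have hSSSN i j k : phi_bracket_spec (Some i) (Some j) (Some k) None.
  by rewrite /phi_bracket_spec /= addbF gl_act_raise mulr0n mulr0 subr0.
have hSSNS i j l : phi_bracket_spec (Some i) (Some j) None (Some l).
  by rewrite /phi_bracket_spec /= gl_act_D mulr0n add0r.
have hSSNN i j : phi_bracket_spec (Some i) (Some j) None None.
  by rewrite /phi_bracket_spec /= andbF gl_act_D0 !mulr0n mulr0 subr0.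
have hSNNS i l : phi_bracket_spec (Some i) None None (Some l).
  by rewrite /phi_bracket_spec /= addbF raise_D.
have hSNNN i : phi_bracket_spec (Some i) None None None.
  by rewrite /phi_bracket_spec /= andbF raise_D0 mulr0n mulr0 subr0.
have hNSNN l : phi_bracket_spec None (Some l) None None.
  by rewrite /phi_bracket_spec /= andbF D_D0 mulr0n add0r mul1r.
case: a b c d => [i|] [j|] [k|] [l|].
- exact: gl_act_bracket.
- exact: hSSSN.
- exact: hSSNS.
- exact: hSSNN.
- exact/phi_bracketC/hSSSN.
- by rewrite /phi_bracket_spec /= !addbF raise_raise !mulr0n mulr0 subr0.
- exact: hSNNS.
- exact: hSNNN.
- exact/phi_bracketC/hSSNS.
- exact/phi_bracketC/hSNNS.
- by rewrite /phi_bracket_spec /= DD !mulr0n mulr0 subr0.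
- exact: hNSNN.
- exact/phi_bracketC/hSSNN.
- exact/phi_bracketC/hSNNN.
- exact/phi_bracketC/hNSNN.
- by rewrite /phi_bracket_spec /= D0D0 mul1r subrr.
Qed.

(** Being of parity p means commuting with the parity involution up to (-1)^p. This is a
    supercommutation with [G] treated as odd, so [sbrMl] shows that parities add in products. *)
Lemma phi_parity (G : A) (a b : option I) :
    (forall i, sbr (bar i) (X i) G = 0) ->
    (forall i, sbr (bar i) (D i) G = 0) ->
    sbr false D0 G = 0 -> (forall i j, sbr (ebar i j) (E i j) G = 0) ->
  sbr (obar a (+) obar b) (phi a b) G = 0.
Proof.
move=> XG DG D0G EG.
have M (px py : bool) x y : sbr px x G = 0 -> sbr py y G = 0 ->
    sbr (px (+) py) (x * y) G = 0.
  move=> xG yG; have := @sbrMl _ px py true x y G; rewrite !andbT => ->.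
  by rewrite xG yG mul0r !mulr0 addr0.
case: a b => [i|] [j|] /=.
- rewrite /gl_act !sbrDl EG M // !add0r.
  case: eqP => [->|_]; last exact: sbr0l.
  by rewrite addbb sbr_zl.
- rewrite /raise sbrDl sbrNl M // sbr_suml big1 ?subrr // => k _.
  rewrite sbr_signl; have -> : bar i (+) false = bar k (+) ebar i k.
    by rewrite /ebar; case: (bar i); case: (bar k).
  by rewrite M ?mulr0.
- exact: DG.
- by rewrite sbrDl D0G z_central addr0.
Qed.

End Realization.

(** * The ring of linear endomorphisms *)

Section LinearEndomorphisms.
Variables (C : fieldType) (W : lmodType C).

(** Packaged as a ring so that operators can be substituted into [phi_bracket]; 1 = 0 is allowed,
    since [W] may be zero. *)
Record lend := LEnd { lend_fun :> W -> W; _ : linear lend_fun }.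

Lemma lend_linear (f : lend) : linear f.
Proof. by case: f. Qed.
HB.instance Definition _ (f : lend) :=
  GRing.isLinear.Build C W W *:%R f (lend_linear f).

Lemma lend_ext (f h : lend) : f =1 h -> f = h.
Proof.
case: f h => [f fP] [h hP] /= /funext fh; case: h / fh hP => hP.
by congr LEnd; exact: Prop_irrelevance.
Qed.

HB.instance Definition _ := gen_eqMixin lend.
HB.instance Definition _ := gen_choiceMixin lend.

Fact lend_zero_linear : linear (fun _ : W => 0 : W).
Proof. by move=> c u v; rewrite scaler0 addr0. Qed.
Fact lend_opp_linear (f : lend) : linear (fun w => - f w).
Proof. by move=> c u v; rewrite linearP opprD scalerN. Qed.
Fact lend_add_linear (f h : lend) : linear (fun w => f w + h w).
Proof. by move=> c u v; rewrite !linearP scalerDr addrACA. Qed.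
Fact lend_one_linear : linear (fun w : W => w).
Proof. by []. Qed.
Fact lend_mul_linear (f h : lend) : linear (fun w => f (h w)).
Proof. by move=> c u v; rewrite !linearP. Qed.

Definition lend_zero := LEnd lend_zero_linear.
Definition lend_opp f := LEnd (lend_opp_linear f).
Definition lend_add f h := LEnd (lend_add_linear f h).
Definition lend_one := LEnd lend_one_linear.
Definition lend_mul f h := LEnd (lend_mul_linear f h).

Fact lend_addA : associative lend_add.
Proof. by move=> f h k; apply: lend_ext => w /=; rewrite addrA. Qed.
Fact lend_addC : commutative lend_add.
Proof. by move=> f h; apply: lend_ext => w /=; rewrite addrC. Qed.
Fact lend_add0 : left_id lend_zero lend_add.
Proof. by move=> f; apply: lend_ext => w /=; rewrite add0r. Qed.
Fact lend_addN : left_inverse lend_zero lend_opp lend_add.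
Proof. by move=> f; apply: lend_ext => w /=; rewrite addNr. Qed.
HB.instance Definition _ :=
  GRing.isZmodule.Build lend lend_addA lend_addC lend_add0 lend_addN.

Fact lend_mulA : associative lend_mul.
Proof. by move=> f h k; apply: lend_ext. Qed.
Fact lend_mul1 : left_id lend_one lend_mul.
Proof. by move=> f; apply: lend_ext. Qed.
Fact lend_mulr1 : right_id lend_one lend_mul.
Proof. by move=> f; apply: lend_ext. Qed.
Fact lend_mulDl : left_distributive lend_mul lend_add.
Proof. by move=> f h k; apply: lend_ext. Qed.
Fact lend_mulDr : right_distributive lend_mul lend_add.
Proof. by move=> f h k; apply: lend_ext => w /=; rewrite linearD. Qed.
HB.instance Definition _ := GRing.Zmodule_isPzRing.Build lend
  lend_mulA lend_mul1 lend_mulr1 lend_mulDl lend_mulDr.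

Lemma lendD (f h : lend) w : (f + h) w = f w + h w. Proof. by []. Qed.
Lemma lendN (f : lend) w : (- f) w = - f w. Proof. by []. Qed.
Lemma lendB (f h : lend) w : (f - h) w = f w - h w. Proof. by []. Qed.
Lemma lendM (f h : lend) w : (f * h) w = f (h w). Proof. by []. Qed.
Lemma lendMn (f : lend) (b : bool) w : (f *+ b) w = b%:R *: f w.
Proof. by case: b; rewrite ?scale1r ?scale0r. Qed.

Lemma lend_signM (b : bool) (f : lend) w : ((-1) ^+ b * f) w = (-1) ^+ b *: f w.
Proof. by case: b; rewrite ?mulN1r ?mul1r ?scaleN1r ?scale1r. Qed.

Lemma lend_sum (J : finType) (f : J -> lend) w :
  (\sum_j f j) w = \sum_j f j w.
Proof. by apply: (big_morph (fun h : lend => h w)). Qed.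

Lemma lend_sbr (b : bool) (f h : lend) w :
  (sbr b f h) w = f (h w) - (-1) ^+ b *: h (f w).
Proof. by rewrite /sbr lendB lend_signM. Qed.

Fact lend_scale_linear (c : C) : linear (fun w : W => c *: w).
Proof. by move=> b u v; rewrite scalerDr !scalerA mulrC. Qed.
Definition lend_scale c := LEnd (lend_scale_linear c).

Lemma lend_scale_central c f : sbr false (lend_scale c) f = 0.
Proof. by apply: lend_ext => w; rewrite lend_sbr scale1r /= linearZ subrr. Qed.

End LinearEndomorphisms.

(* Unification unfolds the Fock space when it is asked to match one of its    *)
(* operators, so the relations are first derived for abstract operators.      *)
Section Relations.
Variables (C : fieldType) (m n : nat) (F V W : lmodType C).
Local Notation I := 'I_(m + n).
Implicit Types (x y : F) (v : V) (i j k l : I).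
Variables (ot od : I -> F -> F) (od0 : F -> F) (par : bool -> F -> F).
Variables (g : V -> V) (e : I -> I -> V -> V) (tp : F -> V -> W).
Hypothesis otC : forall i j x,
  ot i (ot j x) = (-1) ^+ (bar i && bar j) *: ot j (ot i x).
Hypothesis odC : forall i j x,
  od i (od j x) = (-1) ^+ (bar i && bar j) *: od j (od i x).
Hypothesis odt : forall i j x, od i (ot j x) =
  (i == j)%:R *: x + (-1) ^+ (bar i && bar j) *: ot j (od i x).
Hypothesis od0_t : forall i x, od0 (ot i x) = ot i (od0 x) - ot i x.
Hypothesis od0_d : forall i x, od0 (od i x) = od i (od0 x) + od i x.
Hypothesis par_t : forall p i x,
  par p (ot i x) = (-1) ^+ (p && bar i) *: ot i (par p x).
Hypothesis par_d : forall p i x,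
  par p (od i x) = (-1) ^+ (p && bar i) *: od i (par p x).
Hypothesis par_d0 : forall p x, par p (od0 x) = od0 (par p x).
Hypothesis parD : forall p q x, par p (par q x) = par (p (+) q) x.
Hypothesis e_parity : forall i j v,
  e i j (g v) = (-1) ^+ ebar i j *: g (e i j v).
Hypothesis e_bracket : forall i j k l v,
  e i j (e k l v) - (-1) ^+ (ebar i j && ebar k l) *: e k l (e i j v) =
  (j == k)%:R *: e i l v
    - (-1) ^+ (ebar i j && ebar k l) *: ((i == l)%:R *: e k j v).
Hypothesis tp_linear_l : forall v, linear (fun x => tp x v).
Hypothesis tp_linear_r : forall x, linear (tp x).
Hypothesis tp_ext : forall f h : lend W,
  (forall x v, f (tp x v) = h (tp x v)) -> f = h.

Let tpDl x y v : tp (x + y) v = tp x v + tp y v.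
Proof. by have := tp_linear_l v 1 x y; rewrite !scale1r. Qed.
Let tpBl x y v : tp (x - y) v = tp x v - tp y v.
Proof.
by have := tp_linear_l v (-1) y x; rewrite !scaleN1r ![- _ + _]addrC. Qed.
Let tpZl c x v : tp (c *: x) v = c *: tp x v.
Proof.
have tp0 : tp 0 v = 0 by rewrite -[X in tp X v](subrr 0) tpBl subrr.
by have := tp_linear_l v c x 0; rewrite !addr0 tp0 addr0.
Qed.
Let tpBr x u v : tp x (u - v) = tp x u - tp x v.
Proof.
by have := tp_linear_r x (-1) v u; rewrite !scaleN1r ![- _ + _]addrC. Qed.
Let tpZr c x v : tp x (c *: v) = c *: tp x v.
Proof.
have tp0 : tp x 0 = 0 by rewrite -[X in tp x X](subrr 0) tpBr subrr.
by have := tp_linear_r x c v 0; rewrite !addr0 tp0 addr0.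
Qed.
Variables (tX tD : I -> lend W) (tD0 tG : lend W) (tE : I -> I -> lend W).
Hypothesis tX_tp : forall i x v, tX i (tp x v) = tp (ot i x) v.
Hypothesis tD_tp : forall i x v, tD i (tp x v) = tp (od i x) v.
Hypothesis tD0_tp : forall x v, tD0 (tp x v) = tp (od0 x) v.
Hypothesis tE_tp : forall i j x v,
  tE i j (tp x v) = tp (par (ebar i j) x) (e i j v).
Hypothesis tG_tp : forall x v, tG (tp x v) = tp (par true x) (g v).

Lemma tXX i j : sbr (bar i && bar j) (tX i) (tX j) = 0.
Proof.
apply: tp_ext => x v; rewrite lend_sbr !tX_tp otC tpZl subrr.
reflexivity.
Qed.

Lemma tDD i j : sbr (bar i && bar j) (tD i) (tD j) = 0.
Proof.
apply: tp_ext => x v; rewrite lend_sbr !tD_tp odC tpZl subrr.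
reflexivity.
Qed.

Lemma tDX i j : sbr (bar i && bar j) (tD i) (tX j) = (i == j)%:R.
Proof.
apply: tp_ext => x v; rewrite lend_sbr tX_tp !tD_tp tX_tp odt.
by rewrite tpDl tpZl tpZl addrK lendMn.
Qed.

Lemma tD0X i : sbr false tD0 (tX i) = - tX i.
Proof.
apply: tp_ext => x v; rewrite lend_sbr tX_tp !tD0_tp tX_tp od0_t.
by rewrite scale1r tpBl addrAC subrr add0r lendN tX_tp.
Qed.

Lemma tD0D i : sbr false tD0 (tD i) = tD i.
Proof.
apply: tp_ext => x v; rewrite lend_sbr tD_tp !tD0_tp tD_tp od0_d.
by rewrite scale1r tpDl addrAC subrr add0r.
Qed.

Lemma tEX i j k : sbr (ebar i j && bar k) (tE i j) (tX k) = 0.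
Proof.
apply: tp_ext => x v; rewrite lend_sbr tX_tp !tE_tp tX_tp.
by rewrite par_t tpZl subrr.
Qed.

Lemma tED i j k : sbr (ebar i j && bar k) (tE i j) (tD k) = 0.
Proof.
apply: tp_ext => x v; rewrite lend_sbr tD_tp !tE_tp tD_tp.
by rewrite par_d tpZl subrr.
Qed.

Lemma tED0 i j : sbr false (tE i j) tD0 = 0.
Proof.
apply: tp_ext => x v; rewrite lend_sbr tD0_tp !tE_tp tD0_tp.
by rewrite par_d0 scale1r subrr.
Qed.

Lemma tEE i j k l : sbr (ebar i j && ebar k l) (tE i j) (tE k l) =
  tE i l *+ (j == k) - (-1) ^+ (ebar i j && ebar k l) * (tE k j *+ (i == l)).
Proof.
apply: tp_ext => x v; rewrite lend_sbr !tE_tp !parD.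
rewrite [ebar k l (+) _]addbC -tpZr -tpBr e_bracket tpBr !tpZr.
rewrite lendB lend_signM !lendMn !tE_tp.
congr (_ - _ *: _).
  case: eqP => [->|_]; last by rewrite !scale0r.
  by congr (_ *: tp (par _ _) _); rewrite /ebar; case: (bar i);
    case: (bar k); case: (bar l).
case: eqP => [->|_]; last by rewrite !scale0r.
congr (_ *: tp (par _ _) _); rewrite /ebar.
by case: (bar l); case: (bar k); case: (bar j).
Qed.

Lemma tXG i : sbr (bar i) (tX i) tG = 0.
Proof.
apply: tp_ext => x v; rewrite lend_sbr tX_tp !tG_tp tX_tp.
by rewrite par_t tpZl scalerA -signr_addb addbb scale1r subrr.
Qed.

Lemma tDG i : sbr (bar i) (tD i) tG = 0.
Proof.
apply: tp_ext => x v; rewrite lend_sbr tD_tp !tG_tp tD_tp.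
by rewrite par_d tpZl scalerA -signr_addb addbb scale1r subrr.
Qed.

Lemma tD0G : sbr false tD0 tG = 0.
Proof.
apply: tp_ext => x v; rewrite lend_sbr tD0_tp !tG_tp tD0_tp.
by rewrite par_d0 scale1r subrr.
Qed.

Lemma tEG i j : sbr (ebar i j) (tE i j) tG = 0.
Proof.
apply: tp_ext => x v; rewrite lend_sbr !(tE_tp, tG_tp) !parD.
by rewrite e_parity tpZr addbC subrr.
Qed.

Variable rho : C.
Let tphi := phi tX tD tD0 (lend_scale W rho) tE.

Lemma tphi_bracket (a b c d : option I) w :
  let p := (obar a (+) obar b) && (obar c (+) obar d) in
  tphi a b (tphi c d w) - (-1) ^+ p *: tphi c d (tphi a b w) =
    (b == c)%:R *: tphi a d w - (-1) ^+ p *: ((a == d)%:R *: tphi c b w).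
Proof.
move=> p; have := phi_bracket tXX tDD tDX tD0X tD0D tEX tED tED0 tEE
  (lend_scale_central rho) a b c d.
move=> /(congr1 (fun f : lend W => f w)).
by rewrite lend_sbr lendB lend_signM !lendMn.
Qed.

Lemma tphi_parity (a b : option I) w :
  tphi a b (tG w) = (-1) ^+ (obar a (+) obar b) *: tG (tphi a b w).
Proof.
have := phi_parity (lend_scale_central rho) a b tXG tDG tD0G tEG.
by move=> /(congr1 (fun f : lend W => f w)); rewrite lend_sbr => /eqP;
  rewrite subr_eq0 => /eqP.
Qed.

Lemma tphi_gl i j x v : tphi (Some i) (Some j) (tp x v) =
  tp (ot i (od j x)) v + tp (par (ebar i j) x) (e i j v)
    + ((i == j)%:R * ((-1) ^+ (bar i && bar j) * rho)) *: tp x v.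
Proof.
rewrite -[tphi _ _]/(gl_act tX tD (lend_scale W rho) tE i j) /gl_act.
rewrite !lendD lendMn lend_signM lendM tD_tp tX_tp tE_tp.
by rewrite -!scalerA.
Qed.

Lemma tphi_raise i x v : tphi (Some i) None (tp x v) =
  tp (ot i (od0 x)) v - \sum_j (-1) ^+ (bar i && bar j) *:
    tp (ot j (par (ebar i j) x)) (e i j v).
Proof.
rewrite -[tphi _ _]/(raise tX tD0 tE i) /raise lendB lendM tD0_tp tX_tp.
rewrite /twist lend_sum.
congr (_ - _); apply: eq_bigr => j _.
by rewrite lend_signM lendM tE_tp tX_tp.
Qed.

Lemma tphi_00 x v : tphi None None (tp x v) = tp (od0 x) v + rho *: tp x v.
Proof. by rewrite -[tphi _ _]/(tD0 + _) lendD tD0_tp. Qed.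

End Relations.

(** * The gl(m+1|n)-module structure on the tensor product *)

Section FockModule.
Variables (C : fieldType) (m n : nat) (V : lmodType C).
Local Notation I := 'I_(m + n).
Local Notation F := (fock C m n).
Local Notation T := (fock_tensor m n V).
Implicit Types (x y : F) (v : V) (w : T) (i j k l : I).

Lemma parity_pow_t p i x :
  parity_pow p (op_t i x) = (-1) ^+ (p && bar i) *: op_t i (parity_pow p x).
Proof. by case: p; rewrite /= ?scale1r // fock_parity_t. Qed.

Lemma parity_pow_d p i x :
  parity_pow p (op_d i x) = (-1) ^+ (p && bar i) *: op_d i (parity_pow p x).
Proof. by case: p; rewrite /= ?scale1r // fock_parity_d. Qed.

Lemma parity_pow_d0 p a x :
  parity_pow p (op_d0 a x) = op_d0 a (parity_pow p x).
Proof. by case: p => [|//]; exact: fock_parity_d0. Qed.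

Lemma parity_powD p q x :
  parity_pow p (parity_pow q x) = parity_pow (p (+) q) x.
Proof. by case: p; case: q; do ?reflexivity; exact: fock_parityK. Qed.

Lemma pureZl c x v : pure (c *: x) v = c *: pure x v :> T.
Proof. by rewrite -![pure _ v]/(purel v _) linearZ. Qed.
Definition tens p (A : F -> F) (B : {linear V -> V}) : lend T :=
  LEnd (tensor_op_linear p A B).

Lemma tensE p (A : {linear F -> F}) (B : {linear V -> V}) x v :
  tens p A B (pure x v) = pure (A (parity_pow p x)) (B v).
Proof. exact: tensor_op_pure. Qed.

Lemma lend_pure_ext (f h : lend T) :
  (forall x v, f (pure x v) = h (pure x v)) -> f = h.
Proof. by move=> fh; apply: lend_ext; exact: tensor_linear_ext. Qed.

Definition linear_of (f : V -> V) (fP : linear f) : {linear V -> V} :=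
  HB.pack f (GRing.isLinear.Build C V V *:%R f fP).

Definition idL : {linear V -> V} := linear_of (f := id) (fun c u v => erefl).

(** [phi_act] treats t_i d_j as one operator on the first factor, [phi] as a product of two ring
    elements; this identifies them. *)
Lemma tens_comp (A B : {linear F -> F}) :
  tens false (A \o B) idL = tens false A idL * tens false B idL.
Proof.
by apply: lend_pure_ext => x v; rewrite lendM !tensE.
Qed.

Variables (a rho : C) (g : V -> V) (e : I -> I -> V -> V).
Hypothesis He : is_glmodule g e.

Let eL i j : {linear V -> V} := linear_of (act_linear He i j).
Let gL : {linear V -> V} := linear_of (parity_linear He).

Definition opX i : lend T := tens false (op_t i) idL.
Definition opD i : lend T := tens false (op_d i) idL.
Definition opD0 : lend T := tens false (op_d0 a) idL.
Definition opE i j : lend T := tens (ebar i j) idfun (eL i j).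
Definition opG : lend T := tens true idfun gL.
Definition opz : lend T := lend_scale T rho.

Lemma opX_pure i x v : opX i (pure x v) = pure (op_t i x) v.
Proof. exact: tensE. Qed.
Lemma opD_pure i x v : opD i (pure x v) = pure (op_d i x) v.
Proof. exact: tensE. Qed.
Lemma opD0_pure x v : opD0 (pure x v) = pure (op_d0 a x) v.
Proof. exact: tensE. Qed.
Lemma opE_pure i j x v :
  opE i j (pure x v) = pure (parity_pow (ebar i j) x) (e i j v).
Proof. exact: tensE. Qed.
Lemma opG_pure x v : opG (pure x v) = pure (parity_pow true x) (g v).
Proof. exact: tensE. Qed.

Variable r : {poly Ugl C m n}.
Hypothesis central_opE : forall w, central_op a r e w = rho *: w.

Let Phi (A B : 'I_(m.+1 + n)) : lend T :=
  phi opX opD opD0 opz opE (unlift (ord0 : 'I_(m + n).+1) A)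
    (unlift (ord0 : 'I_(m + n).+1) B).

Let opXE i j : opX j * opE i j = tens (ebar i j) (op_t j) (eL i j).
Proof.
apply: lend_pure_ext => x v; rewrite lendM opE_pure opX_pure.
by symmetry; exact: tensE.
Qed.

Let twistE i w : twist opX opE i w = \sum_j (-1) ^+ (bar i && bar j) *:
  tensor_op (ebar i j) (op_t j) (e i j) w.
Proof.
rewrite /twist lend_sum; apply: eq_bigr => j _; rewrite lend_signM opXE.
reflexivity.
Qed.

Lemma phi_actE A B w : phi_act a r e A B w = Phi A B w.
Proof.
rewrite /phi_act /Phi.
case: (unlift _ A) => [i|]; case: (unlift _ B) => [j|];
  lazy beta iota delta [phi]; rewrite ?central_opE.
- rewrite /gl_act !lendD lendMn lend_signM -scalerA -tens_comp.
  reflexivity.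
- rewrite /raise lendB twistE -(tens_comp (op_t i) (op_d0 a)).
  reflexivity.
- by [].
- by [].
Qed.

Lemma obar_unlift (A : 'I_(m.+1 + n)) :
  obar (unlift (ord0 : 'I_(m + n).+1) A) = bar A.
Proof.
by case: unliftP => [i ->|->].
Qed.

Lemma unlift_eq (A B : 'I_(m.+1 + n)) :
  (unlift (ord0 : 'I_(m + n).+1) A == unlift (ord0 : 'I_(m + n).+1) B)
    = (A == B).
Proof.
case: unliftP => [i ->|->]; case: unliftP => [j ->|->] //.
Qed.

Let Phi_bracket := tphi_bracket (F := F) (W := T) (ot := @op_t C m n)
  (od := @op_d C m n) (od0 := op_d0 a) (par := @parity_pow C m n) (e := e)
  (tp := @pure C m n V) (@op_tC C m n) (@op_dC C m n) (@op_dt C m n)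
  (@op_d0_t C m n a) (@op_d0_d C m n a) parity_pow_t parity_pow_d
  (fun p => parity_pow_d0 p a) parity_powD (act_bracket He)
  (@pure_linear_l C m n V) (@pure_linear_r C m n V) lend_pure_ext
  opX_pure opD_pure opD0_pure opE_pure rho.

Let Phi_parity := tphi_parity (F := F) (W := T) (ot := @op_t C m n)
  (od := @op_d C m n) (od0 := op_d0 a) (par := @parity_pow C m n) (e := e)
  (tp := @pure C m n V) parity_pow_t parity_pow_d
  (fun p => parity_pow_d0 p a) parity_powD (act_parity He)
  (@pure_linear_l C m n V) (@pure_linear_r C m n V) lend_pure_ext
  opX_pure opD_pure opD0_pure opE_pure opG_pure rho.

Lemma phi_act_glmodule :
  @is_glmodule C m.+1 n T (tensor_parity g) (phi_act a r e).
Proof.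
have tGE w : tensor_parity g w = opG w by [].
split.
- exact: (tensor_op_linear true id gL).
- move=> w; rewrite !tGE -lendM.
  suff -> : opG * opG = 1 by [].
  apply: lend_pure_ext => x v; rewrite lendM !opG_pure parity_powD.
  by rewrite (parity_invol He).
- by move=> A B c u w; rewrite !phi_actE linearP.
- move=> A B w; rewrite !tGE !phi_actE.
  by have := Phi_parity (unlift ord0 A) (unlift ord0 B) w; rewrite !obar_unlift.
move=> A B K L w; rewrite !phi_actE.
have := Phi_bracket (unlift ord0 A) (unlift ord0 B) (unlift ord0 K)
  (unlift ord0 L) w.
by rewrite !obar_unlift !unlift_eq.
Qed.

Definition lift_index i : 'I_(m.+1 + n) := lift (ord0 : 'I_(m + n).+1) i.

Let phi_act_pureE A B w : phi_act a r e A B w =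
  phi opX opD opD0 opz opE (unlift (ord0 : 'I_(m + n).+1) A)
    (unlift (ord0 : 'I_(m + n).+1) B) w.
Proof. exact: phi_actE. Qed.

Lemma phi_act_gl i j x v :
  phi_act a r e (lift_index i) (lift_index j) (pure x v) =
  pure (op_t i (op_d j x)) v + pure (parity_pow (ebar i j) x) (e i j v)
    + ((i == j)%:R * ((-1) ^+ (bar i && bar j) * rho)) *: pure x v.
Proof.
rewrite phi_act_pureE !liftK.
exact: (tphi_gl (F := F) (W := T) (ot := @op_t C m n) (od := @op_d C m n)
  (par := @parity_pow C m n) (e := e) (tp := @pure C m n V) opD0
  opX_pure opD_pure opE_pure rho).
Qed.

Lemma phi_act_raise i x v : phi_act a r e (lift_index i) ord0 (pure x v) =
  pure (op_t i (op_d0 a x)) v - \sum_j (-1) ^+ (bar i && bar j) *: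
    pure (op_t j (parity_pow (ebar i j) x)) (e i j v).
Proof.
rewrite phi_act_pureE liftK unlift_none.
exact: (tphi_raise (F := F) (W := T) (ot := @op_t C m n) (od0 := op_d0 a)
  (par := @parity_pow C m n) (e := e) (tp := @pure C m n V) opD
  opX_pure opD0_pure opE_pure rho).
Qed.

Lemma phi_act_lower j x v :
  phi_act a r e ord0 (lift_index j) (pure x v) = pure (op_d j x) v.
Proof. by rewrite phi_act_pureE liftK unlift_none; exact: opD_pure. Qed.

Lemma phi_act_00 x v : phi_act a r e ord0 ord0 (pure x v) =
  pure (op_d0 a x) v + rho *: pure x v.
Proof.
rewrite phi_act_pureE unlift_none.
exact: (tphi_00 (F := F) (W := T) (od0 := op_d0 a) (tp := @pure C m n V)
  opX opD opE opD0_pure rho).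
Qed.

End FockModule.

(** * Central elements act by scalars *)

Lemma iter_scale (C : fieldType) (W : lmodType C) (f : W -> W) (a : C) :
  (forall x, f x = a *: x) -> forall k x, iter k f x = a ^+ k *: x.
Proof.
move=> fE; elim=> [|k IH] x; first by rewrite expr0 scale1r.
by rewrite iterS IH fE scalerA exprS.
Qed.

Section CentralScalars.
Variables (C : fieldType) (m n : nat) (V : lmodType C).
Local Notation I := 'I_(m + n).
Variables (g : V -> V) (e : I -> I -> V -> V) (lambda : I -> C) (v : V).
Hypothesis C0 : [pchar C] =i pred0.
Hypothesis He : is_glmodule g e.
Hypothesis hwv : highest_weight_vector e lambda v.
Hypothesis gen : generated_by e v.
Implicit Types (i j k l : I) (x y u : V).

Let eP i j : linear (e i j) := act_linear He i j.
HB.instance Definition _ i j :=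
  GRing.isLinear.Build C V V *:%R (e i j) (eP i j).

(** Words in lowering elements applied to v, indexed by the sum of the drops i - j. Their span plays
    the part of U(n^-) v. *)
Inductive lower_word : nat -> V -> Prop :=
| lower_word_nil : lower_word 0 v
| lower_word_cons h i j x : (j < i)%N -> lower_word h x ->
    lower_word (h + (i - j)) (e i j x).

Inductive lower_span : V -> Prop :=
| lower_span0 : lower_span 0
| lower_spanD c h x y :
    lower_word h x -> lower_span y -> lower_span (c *: x + y).

Lemma lower_span_lin c x y :
  lower_span x -> lower_span y -> lower_span (c *: x + y).
Proof.
move=> xS yS; elim: xS => [|b h z t zL _ IH]; first by rewrite scaler0 add0r.
by rewrite scalerDr scalerA -addrA; exact: lower_spanD zL IH.
Qed.

Lemma lower_spanZ c x : lower_span x -> lower_span (c *: x).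
Proof.
by move=> xS; rewrite -[c *: x]addr0; apply: lower_span_lin => //;
  exact: lower_span0.
Qed.

Lemma lower_word_span h x : lower_word h x -> lower_span x.
Proof.
by move=> xL; rewrite -[x]scale1r -[_ *: _]addr0;
  apply: lower_spanD xL lower_span0.
Qed.

Lemma lower_span_low i j x : (j < i)%N -> lower_span x -> lower_span (e i j x).
Proof.
move=> ji; elim=> [|c h z t zL _ IH].
  by rewrite linear0; exact: lower_span0.
by rewrite linearP; exact: lower_spanD (lower_word_cons ji zL) IH.
Qed.

Lemma bracketE i j k l x : e i j (e k l x) =
  (-1) ^+ (ebar i j && ebar k l) *: e k l (e i j x) +
  ((j == k)%:R *: e i l x
    - (-1) ^+ (ebar i j && ebar k l) *: ((i == l)%:R *: e k j x)).
Proof. by rewrite -(act_bracket He) addrC subrK. Qed.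

(** A Cartan or raising element is moved to the right past the first letter. The bracket terms act
    on the shorter word, where induction applies, and at the end v is a weight vector killed by
    raising elements. *)
Lemma lower_word_act h x i j : lower_word h x -> lower_span (e i j x).
Proof.
have [ji|ij] := ltnP j i.
  by move=> /lower_word_span; exact: lower_span_low.
move=> xL; elim: xL i j ij => [|{}h k l {}x lk xL IH] i j ij.
  case: hwv => _ vl vn; move: ij; rewrite leq_eqVlt => /predU1P[/val_inj ->|ij].
    by rewrite vl; exact/lower_spanZ/(lower_word_span lower_word_nil).
  by rewrite vn //; exact: lower_span0.
have act i' j' : lower_span (e i' j' x).
  have [ji'|] := ltnP j' i'; last exact: IH.
  exact/lower_span_low/lower_word_span/xL.
rewrite bracketE; apply: lower_span_lin; first exact/lower_span_low/act.
apply: lower_span_lin; first exact: act.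
by rewrite -scaleNr; apply: lower_spanZ; exact/lower_spanZ/act.
Qed.

Lemma lower_span_full x : lower_span x.
Proof.
apply: gen; last exact: lower_word_span lower_word_nil.
split=> [|c y z yS zS|i j y]; first exact: lower_span0.
  exact: lower_span_lin.
elim=> [|c h z t zL _ IH]; first by rewrite linear0; exact: lower_span0.
by rewrite linearP; apply: lower_span_lin IH; exact: lower_word_act zL.
Qed.

(* [e i j] with [j < i] raises the eigenvalue of this operator by [i - j].    *)
Definition height (x : V) : V := \sum_(i : I) (i : nat)%:R *: e i i x.

Lemma height_linear : linear height.
Proof.
move=> c x y; rewrite /height scaler_sumr -big_split; apply: eq_bigr => i _ /=.
by rewrite linearP scalerDr !scalerA mulrC.
Qed.
HB.instance Definition _ :=
  GRing.isLinear.Build C V V *:%R height height_linear.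

Lemma height_act k l x : (l < k)%N ->
  height (e k l x) = e k l (height x) + (k - l)%:R *: e k l x.
Proof.
move=> lk; rewrite [in RHS]/height linear_sum natrB 1?ltnW // scalerBl.
have -> : (k : nat)%:R *: e k l x =
    \sum_(i : I) (i : nat)%:R *: ((i == k)%:R *: e i l x).
  rewrite (bigD1 k) //= big1 ?addr0 => [|i /negPf ->].
    by rewrite eqxx scale1r.
  by rewrite scale0r scaler0.
have -> : (l : nat)%:R *: e k l x =
    \sum_(i : I) (i : nat)%:R *: ((i == l)%:R *: e k i x).
  rewrite (bigD1 l) //= big1 ?addr0 => [|i /negPf ->].
    by rewrite eqxx scale1r.
  by rewrite scale0r scaler0.
rewrite -sumrB -big_split; apply: eq_bigr => i _ /=.
rewrite [e k l (_ *: _)]linearZ bracketE /ebar addbb !scale1r scalerDr scalerBr.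
by [].
Qed.

Let ht0 : C := \sum_(i : I) (i : nat)%:R * lambda i.

Lemma height_weight x :
  (forall i, e i i x = lambda i *: x) -> height x = ht0 *: x.
Proof.
by move=> xw; rewrite scaler_suml; apply: eq_bigr => i _; rewrite xw scalerA.
Qed.

Lemma height_lower_word h x : lower_word h x -> height x = (ht0 + h%:R) *: x.
Proof.
elim=> [|{}h k l {}x lk _ IH].
  by rewrite addr0; apply: height_weight; case: hwv.
by rewrite height_act // IH linearZ -scalerDl natrD addrA.
Qed.

Lemma lower_word0 x : lower_word 0 x -> x = v.
Proof.
move: {-2}0%N (erefl 0%N) => h h0 xL; case: xL h0 => // {}h i j y ji _ /eqP.
by rewrite addn_eq0 subn_eq0 leqNgt ji andbF.
Qed.

(** The product of the operators [height] - ([ht0] + h) for 1 <= h <= H. It kills the words of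
    height 1 to H and, in characteristic 0, multiplies v by a nonzero scalar. *)
Fixpoint height_filter (H : nat) (x : V) : V :=
  if H is h.+1 then
    height (height_filter h x) - (ht0 + h.+1%:R) *: height_filter h x
  else x.

Let filter_coef (H k : nat) : C := \prod_(h < H) (k%:R - h.+1%:R).

Lemma height_filter_linear H : linear (height_filter H).
Proof.
elim: H => //= h IH c x y; rewrite IH linearP scalerDr !scalerA mulrC -scalerA.
by rewrite opprD addrACA -scalerBr.
Qed.

Lemma height_filterE H (k : nat) x : height x = (ht0 + k%:R) *: x ->
  height_filter H x = filter_coef H k *: x.
Proof.
move=> xk; elim: H => [|h IH] /=.
  by rewrite /filter_coef big_ord0 scale1r.
rewrite IH linearZ /= xk !scalerA -scalerBl /filter_coef big_ord_recr /=.
by congr (_ *: _); rewrite mulrC -mulrBl mulrC; congr (_ * _);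
  rewrite opprD addrACA subrr add0r.
Qed.

Lemma filter_coef_eq0 H (k : nat) : (0 < k <= H)%N -> filter_coef H k = 0.
Proof.
case: k => // k kH; rewrite /filter_coef (bigD1 (Ordinal (kH : (k < H)%N))) //=.
by rewrite subrr mul0r.
Qed.

Lemma filter_coef0_neq0 H : filter_coef H 0 != 0.
Proof.
apply/prodf_neq0 => h _.
by rewrite sub0r oppr_eq0 ((pcharf0P C).1 C0).
Qed.

Lemma weight_space_dim1 u :
  (forall i, e i i u = lambda i *: u) -> exists c, u = c *: v.
Proof.
move=> uw; have [c [H uH]] : exists c H, forall H', (H <= H')%N ->
    height_filter H' u = (c * filter_coef H' 0) *: v.
  elim: (lower_span_full u) => [|b h x y xL _ [c [H IH]]].
    exists 0, 0%N => H _; rewrite mul0r scale0r.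
    exact: lin0 (height_filter_linear H).
  (* A filter reaching the largest height that occurs leaves only the words of height 0, which are v
     itself; c collects their coefficients. *)
  exists ((if h == 0%N then b else 0) + c), (maxn h H) => H'.
  rewrite geq_max => /andP[hH HH']; rewrite height_filter_linear IH //.
  rewrite (height_filterE _ (height_lower_word xL)) mulrDl scalerDl.
  congr (_ + _); rewrite scalerA; case: eqP xL => [->|/eqP h0] xL.
    by rewrite (lower_word0 xL).
  by rewrite filter_coef_eq0 ?lt0n ?h0 // mulr0 mul0r !scale0r.
(* Since u has the same height eigenvalue as v, the filter also multiplies u by its nonzero
   coefficient at 0, which can be cancelled. *)
exists c; have := @height_filterE H 0%N u.
rewrite addr0 => /(_ (height_weight uw)); rewrite uH //.
by rewrite mulrC -scalerA => /(scalerI (filter_coef0_neq0 H)) ->.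
Qed.

(** z v has weight lambda, hence equals c v; the vectors on which z acts by c form a submodule
    containing the generator v. *)
Lemma central_scalar (z : Ugl C m n) :
    (forall t : Ugl C m n, GRing.comm z t) ->
  exists c, forall x, uact e z x = c *: x.
Proof.
move=> zC; have comm i j x : uact e z (e i j x) = e i j (uact e z x).
  by rewrite -!(uact_gen He) -!(uactM He) zC.
have zP : linear (uact e z) by exact: (free_actP He).
have [|c zv] := @weight_space_dim1 (uact e z v).
  move=> i; case: hwv => _ vl _; rewrite -comm vl.
  by rewrite -[lambda i *: v]addr0 zP (lin0 zP) addr0.
exists c => x; apply: (gen (S := fun x => uact e z x = c *: x)) => //.
split=> [|b y t yS tS|i j y yS]; first by rewrite (lin0 zP) scaler0.
  by rewrite zP yS tS scalerDr !scalerA mulrC.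
by rewrite comm yS linearZ.
Qed.

Lemma central_op_scalar (a : C) (r : {poly Ugl C m n}) :
    (forall (k : nat) (t : Ugl C m n), GRing.comm r`_k t) ->
  exists rho, forall w, central_op a r e w = rho *: w.
Proof.
move=> rC; have [c cP] := choice (fun k : nat => central_scalar (rC k)).
exists (\sum_(k < size r) a ^+ k * c k) => w; rewrite scaler_suml.
apply: eq_bigr => k _; rewrite /tensor_op.
have eulerX := iter_scale (@eulerE C m n a) k.
transitivity (\sum_(l <- msupp w) (a ^+ k * c k) *: pure << l >> w@_l :
    fock_tensor m n V).
  apply: eq_bigr => l _; rewrite scale1r eulerX cP linearZ /= pureZl scalerA.
  by rewrite mulrC.
rewrite -scaler_sumr; congr (_ *: _); rewrite [RHS]monalgE.
by apply: eq_bigr => l _; rewrite pureU.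
Qed.

End CentralScalars.

(** * Generation by the highest weight vector *)

Section Generation.
Variables (C : fieldType) (m n : nat) (F V W : lmodType C).
Local Notation I := 'I_(m + n).
Implicit Types (x y : F) (w : V) (i j k l : I).
Variables (ot od : I -> F -> F) (par : bool -> F -> F) (od0 : F -> F) (one : F).
Hypothesis ot_linear : forall i, linear (ot i).
Hypothesis od_linear : forall i, linear (od i).
Hypothesis par_linear : forall p, linear (par p).
Hypothesis od0_linear : linear od0.
Hypothesis odt : forall i j x, od i (ot j x) =
  (i == j)%:R *: x + (-1) ^+ (bar i && bar j) *: ot j (od i x).
Hypothesis otC : forall i j x,
  ot i (ot j x) = (-1) ^+ (bar i && bar j) *: ot j (ot i x).
Hypothesis od0_t : forall i x, od0 (ot i x) = ot i (od0 x) - ot i x.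
Hypothesis par_t : forall p i x,
  par p (ot i x) = (-1) ^+ (p && bar i) *: ot i (par p x).
Hypothesis parK : forall p x, par p (par p x) = x.
Hypothesis od_one : forall i, od i one = 0.
Hypothesis par_false : forall x, par false x = x.
Hypothesis par_one : forall p, par p one = one.
Variable a : C.
Hypothesis od0_one : od0 one = a *: one.

HB.instance Definition _ i :=
  GRing.isLinear.Build C F F *:%R (ot i) (ot_linear i).
HB.instance Definition _ i :=
  GRing.isLinear.Build C F F *:%R (od i) (od_linear i).
HB.instance Definition _ p :=
  GRing.isLinear.Build C F F *:%R (par p) (par_linear p).
HB.instance Definition _ := GRing.isLinear.Build C F F *:%R od0 od0_linear.

(** Degree in the t_i with i in I, the power of t_0 being ignored; [one] stands for t_0^a. *)
Inductive homogeneous : nat -> F -> Prop :=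
| homogeneous_one : homogeneous 0 one
| homogeneous_t d i x : homogeneous d x -> homogeneous d.+1 (ot i x)
| homogeneous0 d : homogeneous d 0
| homogeneousP d c x y :
    homogeneous d x -> homogeneous d y -> homogeneous d (c *: x + y).

Lemma homogeneousZ d c x : homogeneous d x -> homogeneous d (c *: x).
Proof.
by move=> xH; rewrite -[c *: x]addr0; apply: homogeneousP => //;
  exact: homogeneous0.
Qed.

Lemma homogeneousD d x y :
  homogeneous d x -> homogeneous d y -> homogeneous d (x + y).
Proof. by move=> xH yH; rewrite -[x]scale1r; exact: homogeneousP. Qed.

Lemma homogeneous_td d x i j : homogeneous d x -> homogeneous d (ot i (od j x)).
Proof.
move=> xH; elim: xH i j => [|{}d k {}x xH IH|{}d|{}d c {}x y _ IHx _ IHy] i j.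
- by rewrite od_one linear0; exact: homogeneous0.
- rewrite odt linearD !linearZ /= otC scalerA.
  apply: homogeneousD; apply: homogeneousZ; exact: homogeneous_t.
- by rewrite !linear0; exact: homogeneous0.
rewrite !linearP; exact: (homogeneousP _ (IHx i j) (IHy i j)).
Qed.

Lemma homogeneous_par d x p : homogeneous d x -> homogeneous d (par p x).
Proof.
elim=> [|{}d k {}x _ IH|{}d|{}d c {}x y _ IHx _ IHy].
- by rewrite par_one; exact: homogeneous_one.
- by rewrite par_t; apply: homogeneousZ; exact: homogeneous_t.
- by rewrite linear0; exact: homogeneous0.
by rewrite linearP; exact: homogeneousP.
Qed.

Lemma homogeneous_od0 d x : homogeneous d x -> od0 x = (a - d%:R) *: x.
Proof.
elim=> [|{}d k {}x _ IH|{}d|{}d c {}x y _ IHx _ IHy].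
- by rewrite subr0.
- rewrite od0_t IH linearZ /= -[X in _ - X]scale1r -scalerBl -natr1.
  by rewrite opprD addrA.
- by rewrite linear0 scaler0.
by rewrite od0_linear IHx IHy scalerDr !scalerA mulrC.
Qed.

Variables (e : I -> I -> V -> V) (lambda : I -> C) (v : V).
Hypothesis hwv : highest_weight_vector e lambda v.
Hypothesis gen : generated_by e v.
Hypothesis a_lambda : forall (i : I) (d : nat),
  a + signed_count C i - (-1) ^+ bar i * lambda i <> d%:R.

Variable tp : F -> V -> W.
Hypothesis tp_linear_l : forall w, linear (fun x => tp x w).
Hypothesis tp_linear_r : forall x, linear (tp x).

Variable M : W -> Prop.
Hypothesis M0 : M 0.
Hypothesis M_lin : forall c (u w : W), M u -> M w -> M (c *: u + w).
Hypothesis M_gl : forall i j x w, M (tp x w) ->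
  M (tp (ot i (od j x)) w + tp (par (ebar i j) x) (e i j w)).
Hypothesis M_raise : forall i x w, M (tp x w) ->
  M (tp (ot i (od0 x)) w - \sum_j (-1) ^+ (bar i && bar j) *:
       tp (ot j (par (ebar i j) x)) (e i j w)).
Hypothesis M_one : M (tp one v).

Lemma M_add (u w : W) : M u -> M w -> M (u + w).
Proof. by move=> uM wM; rewrite -[u]scale1r; exact: M_lin. Qed.
Lemma M_scale c u : M u -> M (c *: u).
Proof. by move=> uM; rewrite -[c *: u]addr0; exact: M_lin. Qed.
Lemma M_sub (u w : W) : M u -> M w -> M (u - w).
Proof. by move=> uM wM; rewrite -scaleN1r addrC; exact: M_lin. Qed.
Lemma M_sum (P : pred I) (f : I -> W) :
  (forall j, P j -> M (f j)) -> M (\sum_(j | P j) f j).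
Proof. by move=> fM; apply: (big_ind M) => //; exact: M_add. Qed.

Let tpDl x y w : tp (x + y) w = tp x w + tp y w.
Proof. by have := tp_linear_l w 1 x y; rewrite !scale1r. Qed.
Let tp0l w : tp 0 w = 0.
Proof. exact: lin0 (tp_linear_l w). Qed.
Let tpZl c x w : tp (c *: x) w = c *: tp x w.
Proof. by have := tp_linear_l w c x 0; rewrite !addr0 tp0l addr0. Qed.
Let tp0r x : tp x 0 = 0.
Proof. exact: lin0 (tp_linear_r x). Qed.
Let tpZr c x w : tp x (c *: w) = c *: tp x w.
Proof. by have := tp_linear_r x c w 0; rewrite !addr0 tp0r addr0. Qed.

(* The elements of gl(m|n) act on both factors; the action on the first one   *)
(* preserves the degree, so it can be subtracted.                             *)
Lemma homogeneous_full d : (forall x, homogeneous d x -> M (tp x v)) ->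
  forall x w, homogeneous d x -> M (tp x w).
Proof.
move=> vM x w; move: w x.
apply: (gen (S := fun w => forall x, homogeneous d x -> M (tp x w))) => //.
split=> [x _|c u w uM wM x xH|i j w wM x xH]; first by rewrite tp0r.
  by rewrite tp_linear_r; apply: M_lin; auto.
(* The sign rule applies [par] to the first factor, so e_ij is applied to [par x (x) w] to get x
   back. *)
have x'H := homogeneous_par (ebar i j) xH.
have := M_sub (M_gl i j (wM _ x'H)) (wM _ (homogeneous_td i j x'H)).
by rewrite parK addrC addKr.
Qed.

(** Apply e_ij to t_j x (x) v. On the first factor t_i d_j gives t_i x plus a multiple of t_j (t_i
    d_j x), and the latter is in M because t_i d_j x again has degree d. Summed over j < i, the
    signs (-1)^|j| add up to f(i). *)
Lemma raise_coef i j d x : (j < i)%N -> homogeneous d x ->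
    (forall y, homogeneous d y -> M (tp (ot j y) v)) ->
  M ((-1) ^+ (bar i && bar j) *: tp (ot j (par (ebar i j) x)) (e i j v)
     + (-1) ^+ bar j *: tp (ot i x) v).
Proof.
move=> ji xH jM; have := M_gl i j (jM x xH); rewrite par_t tpZl.
rewrite odt eqxx scale1r linearD linearZ /= otC scalerA tpDl tpZl => h.
pose s : C := (-1) ^+ (bar j && bar j) * (-1) ^+ (bar i && bar j).
have := M_sub h (M_scale s (jM _ (homogeneous_td i j xH))).
rewrite addrAC addrK => /(M_scale ((-1) ^+ bar j)).
rewrite scalerDr scalerA -signr_addb addrC /ebar.
by case: (bar i) (bar j) => [] [].
Qed.

(* Acting with the elements [e_i0], the vectors [t_j x (x) v] with [j < i]    *)
(* being known, leaves [t_i x (x) v] times a number that [a_lambda] makes     *)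
(* invertible.                                                                *)
Lemma raise_full d : (forall x, homogeneous d x -> M (tp x v)) ->
  forall i x, homogeneous d x -> M (tp (ot i x) v).
Proof.
move=> xM i; have [k] := ubnP (i : nat).
elim: k i => // k IH i ik x xH.
have jM j : (j < i)%N -> forall y, homogeneous d y -> M (tp (ot j y) v).
  by move=> ji; apply: IH; exact: leq_trans ji ik.
pose S j := (-1) ^+ (bar i && bar j) *: tp (ot j (par (ebar i j) x)) (e i j v).
(* For j > i the element e_ij kills v, and e_ii gives lambda_i; the terms with j < i are left to
   [raise_coef]. *)
have S_sum : \sum_j S j =
    ((-1) ^+ bar i * lambda i) *: tp (ot i x) v + \sum_(j : I | (j < i)%N) S j.
  rewrite (bigID (fun j : I => (j < i)%N)) /= addrC; congr (_ + _).
  case: hwv => _ vl vn; rewrite (bigD1 i) ?ltnn //= big1 ?addr0 => [|j].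
    by rewrite /S /ebar addbb par_false andbb vl tpZr scalerA.
  rewrite -leqNgt => /andP[ij ji]; rewrite /S vn ?tp0r ?scaler0 //.
  by rewrite ltn_neqAle ij andbT eq_sym.
have := M_raise i (xM x xH); rewrite (homogeneous_od0 xH) linearZ /= tpZl.
rewrite -/(S _) S_sum => h.
have := M_add h (M_sum (fun j ji => raise_coef ji xH (jM j ji))).
rewrite big_split /= -scaler_suml opprD !addrA addrNK -scalerBl -scalerDl.
have c0 : a - d%:R - (-1) ^+ bar i * lambda i + signed_count C i != 0.
  apply/eqP => c0; apply: (a_lambda (i := i) (d := d)).
  apply/eqP; rewrite -subr_eq0 -c0; apply/eqP.
  by rewrite [RHS]addrAC [in RHS](addrAC a) addrAC.
set c := (_ + signed_count C i) in c0 *.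
by move=> /(M_scale c^-1); rewrite scalerA mulVf // scale1r.
Qed.

Lemma homogeneous_tensor d x w : homogeneous d x -> M (tp x w).
Proof.
move: x w; elim: d => [|d IH]; apply: homogeneous_full.
  move=> x; move: {-2}0%N (erefl 0%N) => d d0 xH.
  elim: xH d0 => // [{}d _|{}d c {}x y _ IHx _ IHy d0]; first by rewrite tp0l.
  by rewrite tp_linear_l; apply: M_lin; auto.
move=> x; move: {-2}d.+1 (erefl d.+1) => d' d'E xH.
elim: xH d'E => // [{}d' i {}x xH _ [dd']|{}d' _|{}d' c {}x y _ IHx _ IHy d0].
- by apply: (@raise_full d) => [y|]; [exact: IH | rewrite -dd'].
- by rewrite tp0l.
by rewrite tp_linear_l; apply: M_lin; auto.
Qed.

End Generation.

(** * Assembly: the vector t_0^a (x) v and the main result *)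

Section HighestWeightModule.
Variables (C : fieldType) (m n : nat) (V : lmodType C).
Local Notation I := 'I_(m + n).
Local Notation F := (fock C m n).
Local Notation T := (fock_tensor m n V).
Local Notation lift_index := (@lift_index m n).
Implicit Types (i j : I).

Definition exponent0 : exponent m n := [ffun=> 0%N].

Lemma admissible0 : admissible exponent0.
Proof. by apply/forallP => i; rewrite ffunE implybT. Qed.

Definition vac : F := fmon C exponent0.

Lemma op_d_vac i : op_d i vac = 0.
Proof. by rewrite /vac op_d_fmon0 // ffunE. Qed.

Lemma parity_pow_vac p : parity_pow p vac = vac.
Proof.
case: p => [|//]; rewrite /parity_pow /vac fock_parity_fmon.
by rewrite /odd_exponent big1 ?scale1r // => i _; rewrite ffunE.
Qed.

Lemma op_d0_vac a : op_d0 a vac = a *: vac.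
Proof. by rewrite /vac op_d0_fmon big1 ?subr0 // => i _; rewrite ffunE. Qed.

Lemma pure0l (v : V) : pure 0 v = 0 :> T.
Proof. exact: lin0 (@pure_linear_l C m n V v). Qed.

Lemma pure_vac_neq0 (v : V) : v != 0 -> pure vac v != 0 :> T.
Proof.
have -> : vac = << (Sub exponent0 admissible0 : monomial m n) >>.
  by rewrite -fmonU SubK.
by rewrite pureU => v0; apply: contra v0; rewrite monalgU_eq0.
Qed.

(** Some t_i with k_i > 0 is split off, up to a sign. As [op_t_fmon] holds for every exponent,
    inadmissible k need no separate case. *)
Lemma fmon_homogeneous (k : exponent m n) :
  homogeneous (@op_t C m n) vac (\sum_i k i) (fmon C k).
Proof.
move: {2}(\sum_i k i)%N (erefl (\sum_i k i)%N) => d.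
elim: d k => [|d IH] k kd; rewrite kd.
  suff -> : k = exponent0 by exact: homogeneous_one.
  apply/ffunP => i; rewrite ffunE; move/eqP: kd.
  by rewrite sum_nat_eq0 => /forallP/(_ i)/eqP.
have [i ki] : exists i, (0 < k i)%N.
  apply/existsP; rewrite -[X in is_true X]negbK negb_exists.
  apply/negP => /forallP k0.
  move: kd; rewrite big1 // => i _; apply/eqP; rewrite -leqn0 leqNgt; exact: k0.
have e : fmon C k = move_sign C i (decr i k) *: op_t i (fmon C (decr i k)).
  by rewrite op_t_fmon scalerA move_sign_sqr scale1r decrK.
have dd : (\sum_j decr i k j = d)%N.
  by apply/eqP; rewrite -eqSS -kd -[in X in _ == X](decrK ki) sum_incr addn1.
rewrite e; apply: homogeneousZ; apply: homogeneous_t.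
by have := IH (decr i k) dd; rewrite dd.
Qed.

Variables (a : C) (r : {poly Ugl C m n}) (lambda : I -> C).
Variables (g : V -> V) (e : I -> I -> V -> V).
Hypothesis C0 : [pchar C] =i pred0.
Hypothesis r_central : forall (k : nat) (u : Ugl C m n), GRing.comm r`_k u.
Hypothesis V_lambda : is_simple_hw g e lambda.
Hypothesis a_lambda : forall (i : I) (k : nat),
  a + signed_count C i - (-1) ^+ bar i * lambda i <> k%:R.

Theorem fock_tensor_highest_weight :
  @highest_weight_module C m.+1 n T (tensor_parity g) (phi_act a r e).
Proof.
case: V_lambda => He _ [v [hwv gen]].
have [rho cE] := central_op_scalar C0 He hwv gen a r_central.
split; first exact (phi_act_glmodule He cE).
have [v0 vl vn] := hwv.
have act_gl := phi_act_gl He cE; have act_raise := phi_act_raise He cE.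
have act_lower := phi_act_lower He cE; have act_00 := phi_act_00 He cE.
(* On t_0^a (x) v the operators t_i d_i vanish and t_0 d_0 gives a; R adds rho times the
   supertrace. *)
pose mu (A : 'I_(m.+1 + n)) := if unlift (ord0 : 'I_(m + n).+1) A is Some i
  then lambda i + (-1) ^+ bar i * rho else a + rho.
exists mu, (pure vac v); split.
  split; first exact: pure_vac_neq0.
    move=> A; rewrite /mu.
    case: (unliftP (ord0 : 'I_(m + n).+1) A) => [i ->|->].
      rewrite (act_gl i i) op_d_vac (linear0 (op_t i)) parity_pow_vac vl.
      rewrite linearZ /=.
      by rewrite pure0l add0r eqxx mul1r andbb -scalerDl.
    by rewrite act_00 op_d0_vac pureZl -scalerDl.
  move=> A B; case: (unliftP (ord0 : 'I_(m + n).+1) A) => [i ->|->];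
    case: (unliftP (ord0 : 'I_(m + n).+1) B) => [j ->|->] // ij.
    rewrite (act_gl i j) op_d_vac (linear0 (op_t i)) vn // linear0.
    have -> : i == j = false by apply/eqP => ijE; rewrite ijE ltnn in ij.
    by rewrite pure0l !add0r mul0r scale0r.
  by rewrite (act_lower j) op_d_vac pure0l.
move=> S [S0 S_lin S_act] Sv w.
(* On the diagonal R adds only a scalar multiple of the vector itself, which can be subtracted
   within S. *)
have S_gl i j x u : S (pure x u) ->
    S (pure (op_t i (op_d j x)) u + pure (parity_pow (ebar i j) x) (e i j u)).
  move=> Sxu; have := S_act (lift_index i) (lift_index j) _ Sxu; rewrite act_gl.
  set c := _ * _; move=> /(S_lin (- c) _ _ Sxu).
  by rewrite scaleNr addrC addrK.
have S_raise i x u : S (pure x u) -> S (pure (op_t i (op_d0 a x)) u -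
    \sum_j (-1) ^+ (bar i && bar j) *:
      pure (op_t j (parity_pow (ebar i j) x)) (e i j u)).
  by move=> Sxu; rewrite -act_raise; exact: S_act.
have parK p (x : F) : parity_pow p (parity_pow p x) = x.
  by rewrite parity_powD addbb.
have Sk (k : monomial m n) u : S (pure (<< k >> : F) u).
  rewrite -fmonU.
  exact: (homogeneous_tensor (F := F) (W := T)
    (fun i => @fock_ext_linear C m n _) (fun i => @fock_ext_linear C m n _)
    (@parity_pow_linear C m n) (@fock_ext_linear C m n _)
    (@op_dt C m n) (@op_tC C m n) (@op_d0_t C m n a) (@parity_pow_t C m n)
    parK op_d_vac (fun x => erefl x) parity_pow_vac (op_d0_vac a) hwv gen
    a_lambda (@pure_linear_l C m n V) (@pure_linear_r C m n V) S0 S_lin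
    S_gl S_raise Sv u (fmon_homogeneous (val k))).
have S_add (x y : T) : S x -> S y -> S (x + y).
  by move=> Sx Sy; rewrite -[x]scale1r; exact: S_lin.
rewrite (monalgE w); elim: (enum_fset _) => [|k s IH]; first by rewrite big_nil.
rewrite big_cons; apply: S_add IH.
by have := Sk k (mcoeff k w); rewrite pureU.
Qed.

End HighestWeightModule.

Theorem theorem4p2 (R : realType) (m n : nat) (a : R[i])
    (r : {poly Ugl R[i] m n})
    (r_central : forall (k : nat) (u : Ugl R[i] m n), GRing.comm r`_k u)
    (lambda : 'I_(m + n) -> R[i])
    (L : lmodType R[i]) (g : L -> L) (e : 'I_(m + n) -> 'I_(m + n) -> L -> L)
    (L_lambda : is_simple_hw g e lambda)
    (a_lambda : forall (i : 'I_(m + n)) (k : nat),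
       a + signed_count R[i] i - (-1) ^+ bar i * lambda i <> k%:R) :
  @highest_weight_module R[i] m.+1 n (fock_tensor m n L)
    (tensor_parity g) (phi_act a r e).
Proof.
exact: fock_tensor_highest_weight (Num.Theory.pchar_num _) r_central L_lambda
  a_lambda.
Qed.
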